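(* Let $g:{\cal L}\to\mathbb{C}$, let $\tilde g=g-E_{\pi^Q}g$, and $\tilde S_n=\sum_{j=0}^n\tilde g(Z_j)$. Then: 1. (Weak Law of Large Numbers) For $\epsilon>0$, $\displaystyle\lim_{n\to\infty}Q_n\left(\left|\frac{\tilde S_n}{n+1}\right|>\epsilon\right)=0$. 2. (Central Limit Theorem) $\displaystyle Q_n\left(\frac{\tilde S_n}{\sqrt{n+1}}\le x\right)\Rightarrow P(Y\le x)$ as $n\to\infty$ (convergence in distribution), where $Y\sim N(0,\sigma^2)$ and $\sigma^2=E_{\pi^Q}\left[\tilde g\,((2Q^{\#}-I)\tilde g)\right]$.
   Context: $Z=(Z_n:n\in\mathbb{Z}_+)$, $\mathbb{Z}_+=\{0,1,\dots\}$, is an irreducible and aperiodic Markov chain on a finite state space ${\cal L}$ with transition function $Q$ and stationary distribution $\pi^Q$. $\varphi:{\cal L}\to(0,\infty)$ is a positive function and $\mu$ is a probability distribution on ${\cal L}$. $E^Q_\mu$ is expectation for the chain with transition function $Q$ and initial distribution $\mu$. For $n\in\mathbb{Z}_+$, $Q_n$ is the probability measure on $\sigma(Z_0,\dots,Z_n)$ given by $$Q_n(A)=\frac{E^Q_\mu\left(\mathbf 1_A/\varphi(Z_n)\right)}{E^Q_\mu\left(1/\varphi(Z_n)\right)}.$$ For a probability distribution $m$ on ${\cal L}$ and $h:{\cal L}\to\mathbb{C}$, $E_mh=\sum_zm(z)h(z)$. Functions on ${\cal L}$ are viewed as column vectors, $(Qh)(z)=\sum_{z'}Q(z,z')h(z')$,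 $I$ is the identity, and products of functions are pointwise. $I-Q$ is invertible on the $Q$-invariant subspace $V=\{h:E_{\pi^Q}h=0\}$; $Q^{\#}$ denotes this inverse on $V$, extended linearly to all functions by $Q^{\#}\mathbf 1=0$. $N(0,\sigma^2)$ denotes the normal distribution with mean $0$ and variance $\sigma^2$.
   Formalization: Part 2 (the Central Limit Theorem) is stated for real-valued g only, since for complex g the event S̃_n/√(n+1) ≤ x and the law N(0,σ²) are not defined; it is also proved that σ² is real and nonnegative. *)

(* Defs.v *)
From HB Require Import structures.
From mathcomp Require Import all_boot all_order all_algebra.
From mathcomp Require Import all_classical all_reals all_analysis.
From mathcomp Require Import complex.

Set Implicit Arguments.
Unset Strict Implicit.
Unset Printing Implicit Defensive.

Import Order.TTheory GRing.Theory Num.Theory.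
Import numFieldNormedType.Exports.

Local Open Scope classical_set_scope.
Local Open Scope complex_scope.
Local Open Scope ring_scope.

Section TransitionFunctions.
Variables (R : realType) (L : finType).
Implicit Types (p : L -> R) (Q : L -> L -> R) (h : L -> R[i]).

Definition is_distribution p : Prop :=
  (forall z, 0 <= p z) /\ \sum_z p z = 1.

Definition is_transition_function Q : Prop :=
  forall z, is_distribution (Q z).

Fixpoint transition_power Q (n : nat) (x y : L) : R :=
  if n is m.+1 then \sum_z Q x z * transition_power Q m z y
  else (x == y)%:R.

Definition irreducible_transition Q : Prop :=
  forall x y, exists n, 0 < transition_power Q n x y.

(* For every x, the only common divisor of the set of possible return times
   {n >= 1 | Q^n(x, x) > 0} is 1, i.e. its gcd is 1. *)
Definition aperiodic_transition Q : Prop :=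
  forall x (d : nat),
    (forall n, (0 < n)%N -> 0 < transition_power Q n x x -> (d %| n)%N) ->
    d = 1%N.

Definition is_stationary p Q : Prop :=
  is_distribution p /\ forall y, \sum_x p x * Q x y = p y.

Definition mean p h : R[i] := \sum_z (p z)%:C * h z.

Definition apply_transition Q h : L -> R[i] :=
  fun z => \sum_z' (Q z z')%:C * h z'.

(* S is linear, kills the constants, and restricts on V = {h | E_p h = 0} to a
   two-sided inverse V -> V of I - Q. *)
Definition is_Qsharp Q p (S : (L -> R[i]) -> (L -> R[i])) : Prop :=
  [/\ forall (a : R[i]) h1 h2,
        S (fun z => a * h1 z + h2 z) = (fun z => a * S h1 z + S h2 z),
      S (fun=> 1) = (fun=> 0) &
      forall h, mean p h = 0 ->
        [/\ mean p (S h) = 0,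
            (fun z => S h z - apply_transition Q (S h) z) = h &
            S (fun z => h z - apply_transition Q h z) = h]].

(* For irreducible Q with stationary distribution p, exactly one operator
   satisfies is_Qsharp Q p. The default value 0 is junk. *)
Definition Qsharp Q p : (L -> R[i]) -> (L -> R[i]) :=
  xget (fun _ _ => 0) [set S | is_Qsharp Q p S].

Definition centered p h : L -> R[i] := fun z => h z - mean p h.

(* E_p[h~ ((2 Q^# - I) h~)] with h~ = h - E_p h; no complex conjugate. *)
Definition asymptotic_variance Q p h : R[i] :=
  mean p (fun z => centered p h z *
    (2 * Qsharp Q p (centered p h) z - centered p h z)).

End TransitionFunctions.

Section Processes.
Variables (R : realType) (L : finType).
Context {d : measure_display} {T : measurableType d}.
Implicit Types (P : probability T R) (Z : nat -> T -> L).

(* The Markov property is written in product form, so that histories of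
   probability zero need no separate treatment. *)
Definition is_markov_chain P Z (mu : L -> R) (Q : L -> L -> R) : Prop :=
  [/\ forall n z, measurable (Z n @^-1` [set z]),
      forall z, P (Z 0%N @^-1` [set z]) = (mu z)%:E &
      forall n (z : nat -> L),
        P [set w | forall i, (i <= n.+1)%N -> Z i w = z i] =
        (P [set w | forall i, (i <= n)%N -> Z i w = z i]
          * (Q (z n) (z n.+1))%:E)%E].

(* Q_n(A), for an event A in the sigma-algebra generated by Z_0, ..., Z_n *)
Definition tilted_prob P Z (phi : L -> R) (n : nat) (A : set T) : R :=
  fine 'E_P[fun w => \1_A w / phi (Z n w)] /
  fine 'E_P[fun w => (phi (Z n w))^-1].

Definition additive_functional Z (h : L -> R[i]) (n : nat) (w : T) : R[i] :=
  \sum_(0 <= j < n.+1) h (Z j w).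

End Processes.

(* N(0, v) for v >= 0. The degenerate law is the Dirac mass at 0, whereas the
   library's normal_prob _ 0 is by convention the uniform law on [0, 1]. *)
Definition centered_normal {R : realType} (v : R) (A : set R) : \bar R :=
  if v == 0 then \d_(0 : R) A else normal_prob 0 (Num.sqrt v) A.

Definition centered_normal_cdf {R : realType} (v x : R) : R :=
  fine (centered_normal v `]-oo, x]).

(* Convergence in distribution, in terms of distribution functions *)
Definition cvg_in_distribution {R : realType}
    (F : nat -> R -> R) (G : R -> R) : Prop :=
  forall x, {for x, continuous G} -> F n x @[n --> \oo] --> G x.

(* Main.v *)
Require Import Defs.
From HB Require Import structures.
From mathcomp Require Import all_boot all_order all_algebra.
From mathcomp Require Import all_classical all_reals all_analysis.
From mathcomp Require Import measurable_realfun complex.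
From mathcomp Require Import ring lra zify.

Set Implicit Arguments.
Unset Strict Implicit.
Unset Printing Implicit Defensive.

Import Order.TTheory GRing.Theory Num.Theory.
Import numFieldNormedType.Exports.

Local Open Scope classical_set_scope.
Local Open Scope complex_scope.
Local Open Scope ring_scope.

(** The sum [S_n] is a martingale up to a bounded error. As [Q] is irreducible
   and aperiodic, some power of [Q] has only positive entries, so the iterates of
   [Q] contract oscillations and [Q^k h] tends to the mean of [h] under the
   stationary law ([ergodic_convergence]). In particular a harmonic function is
   constant, so that [I - Q] is invertible on the functions of mean zero, and the
   Poisson equation [u - Q u = f] is solvable ([poisson_exists]). Then
   [M_n = S_n + (Q u)(Z_n)] is a martingale with bounded increments
   [u(Z_(n+1)) - (Q u)(Z_n)].

   Weak law: the second moment of [M_n] grows linearly, and passing from the law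
   of the chain to the tilted law [Q_n] multiplies expectations of nonnegative
   functions by at most a constant; Chebyshev's inequality concludes
   ([path_wlln]).

   Central limit theorem: Lindeberg's method, with Gaussian distribution functions
   themselves as test functions. The function [heat s x = Phi(x / sqrt s)], the
   distribution function of N(0, s) at [x], solves the heat equation
   [d/ds = (1/2) d^2/dx^2] and, for [s] bounded away from zero, has bounded
   derivatives. Along the chain, [heat s (y - M_k / sqrt n)] changes in one step
   by [V(Z_k) / (2n)] times the second derivative, [V] being the conditional
   variance of the increment; raising [s] by [sigma^2 / n] compensates the mean
   [sigma^2] of [V], and the fluctuation [V - sigma^2], once written [w - Q w],
   telescopes. Hence the mean of [heat d (y - M_n / sqrt n)] tends to
   [heat (d + sigma^2) y] ([lindeberg_bound]). Tilting by [1 / phi(Z_n)] does not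
   matter in the limit: conditioning on the state at time [n - k] replaces this
   weight by [Q^k (1/phi)], almost a constant, whereas the last [k] steps move
   [M_n / sqrt n] by [O(1 / sqrt n)] only ([tilted_heat_limit]). Finally, the
   indicator of [W <= x] lies between two functions [heat d (x -+ a - W)], up to
   Gaussian tails ([heat_sandwich]), and letting the smoothing tend to zero gives
   convergence at every continuity point of the limit, also when [sigma^2 = 0].

   The variance agrees with the formula of the statement because [Q^# g~] is the
   solution [u] of the Poisson equation and
   [g~ (2 u - g~) = (u - Q u) (u + Q u) = u^2 - (Q u)^2], whose mean is the mean
   conditional variance of the increment ([asymptotic_variance_martingale]). *)

(** * Mean value estimates *)

Section MeanValue.
Variable R : realType.
Implicit Types f df : R -> R.

Lemma is_derive_cvg f (x l : R) : is_derive x 1 f l -> {for x, continuous f}.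
Proof. by move=> [d _]; apply/differentiable_continuous/derivable1_diffP. Qed.

Lemma derive_bound_segment f df (a b C : R) : a <= b ->
  (forall x, a <= x <= b -> is_derive x 1 f (df x)) ->
  (forall x, a <= x <= b -> `|df x| <= C) ->
  `|f b - f a| <= C * (b - a).
Proof.
move=> ab fd dfC.
have [||c cab ->] := @MVT_segment R f df a b ab.
- by move=> x xab; apply: fd; rewrite inE/= in xab; case/andP: xab => /ltW -> /ltW ->.
- apply: continuous_in_subspaceT => x; rewrite inE/= in_itv/= => xab.
  exact: is_derive_cvg (fd _ xab).
rewrite normrM [X in _ * X]ger0_norm ?subr_ge0// ler_wpM2r ?subr_ge0//.
by apply: dfC; rewrite in_itv/= in cab.
Qed.

(** Centred at 0 so that increments of both signs are treated at once. *)
Lemma derive_bound f df (h C : R) :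
  (forall x : R, is_derive x 1 f (df x)) ->
  (forall x, `|x| <= `|h| -> `|df x| <= C) ->
  `|f h - f 0| <= C * `|h|.
Proof.
move=> fd dfC; have [h0|/ltW h0] := leP 0 h.
  rewrite [X in _ * X]ger0_norm// -[X in _ * X]subr0.
  apply: (@derive_bound_segment _ df) => // x /andP[x0 xh]; apply: dfC.
  by rewrite !ger0_norm.
rewrite distrC [X in _ * X]ler0_norm// -[X in _ * X]sub0r.
apply: (@derive_bound_segment _ df) => // x /andP[x0 xh]; apply: dfC.
by rewrite !ler0_norm// lerN2.
Qed.

Lemma is_derive_shift f df (x t : R) : (forall x : R, is_derive x 1 f (df x)) ->
  is_derive t 1 (fun t => f (x + t)) (df (x + t)).
Proof.
move=> fd; have -> : df (x + t) = df (x + t) *: (1 : R).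
  by rewrite /GRing.scale/= mulr1.
apply: (@is_derive1_comp _ f (fun t => x + t)).
by rewrite -[X in is_derive _ _ _ X]add0r; exact: is_deriveD.
Qed.

Lemma lipschitz_of_derive f df (C : R) :
  (forall x : R, is_derive x 1 f (df x)) -> (forall x, `|df x| <= C) ->
  forall x h, `|f (x + h) - f x| <= C * `|h|.
Proof.
move=> fd dfC x h.
have := @derive_bound (fun t => f (x + t)) (fun t => df (x + t)) h C.
rewrite /= addr0; apply => // t.
exact: is_derive_shift.
Qed.

(** Integrating the Lipschitz bound on [f2] twice; the constant is not optimal,
   only its independence of [x] matters. *)
Lemma taylor2_bound (f f1 f2 : R -> R) (C : R) :
  (forall x : R, is_derive x 1 f (f1 x)) -> (forall x : R, is_derive x 1 f1 (f2 x)) ->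
  (forall x h, `|f2 (x + h) - f2 x| <= C * `|h|) ->
  forall x h, `|f (x + h) - f x - h * f1 x - h ^+ 2 / 2 * f2 x| <= C * `|h| ^+ 3.
Proof.
move=> fd f1d f2L x h.
have C0 : 0 <= C by have := f2L 0 1; rewrite normr1 mulr1; apply: le_trans.
have B1 k : `|k| <= `|h| -> `|f1 (x + k) - f1 x - k * f2 x| <= C * `|h| ^+ 2.
  move=> kh.
  have := @derive_bound (fun t => f1 (x + t) - t * f2 x)
     (fun t => f2 (x + t) - f2 x) k (C * `|h|).
  rewrite /= addr0 mul0r subr0.
  have -> : f1 (x + k) - k * f2 x - f1 x = f1 (x + k) - f1 x - k * f2 x by ring.
  move=> H; apply: le_trans (H _ _) _ => [t|t tk|].
  - apply: is_deriveB; first exact: is_derive_shift.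
    apply: is_derive_eq; rewrite /GRing.scale/=; ring.
  - by apply: le_trans (f2L _ _) _; rewrite ler_wpM2l// (le_trans tk).
  - by rewrite -mulrA ler_wpM2l// expr2 ler_wpM2l.
have := @derive_bound (fun t => f (x + t) - (t * f1 x + t ^+ 2 / 2 * f2 x))
     (fun t => f1 (x + t) - (f1 x + t * f2 x)) h (C * `|h| ^+ 2).
rewrite /= addr0 mul0r expr0n/= !mul0r addr0 subr0.
have -> : f (x + h) - (h * f1 x + h ^+ 2 / 2 * f2 x) - f x =
  f (x + h) - f x - h * f1 x - h ^+ 2 / 2 * f2 x by ring.
move=> H; apply: le_trans (H _ _) _ => [t|t tk|].
- apply: is_deriveB; first exact: is_derive_shift.
  by apply: is_derive_eq; rewrite /GRing.scale/=; field.
- by have := B1 _ tk; rewrite opprD addrA.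
- by rewrite -mulrA -exprSr.
Qed.

End MeanValue.

(** * The standard Gaussian density and its derivatives *)

Section Gaussian.
Variable R : realType.
Implicit Types x y s r h : R.

Definition gauss : R -> R := normal_pdf 0 1.
Definition gauss1 y := - y * gauss y.
Definition gauss2 y := (y ^+ 2 - 1) * gauss y.

Lemma gauss_ge0 y : 0 <= gauss y. Proof. exact: normal_pdf_ge0. Qed.

Lemma gaussE y : gauss y = normal_peak 1 * expR (- (y ^+ 2 / 2)).
Proof.
rewrite /gauss normal_pdfE ?oner_neq0// /normal_fun expr1n.
by rewrite /= subr0 mulNr.
Qed.

Lemma is_derive_gauss y : is_derive y 1 gauss (gauss1 y).
Proof.
have := @is_derive_expR R (- (y ^+ 2 / 2)).
have dq : is_derive y 1 (fun y : R => - (y ^+ 2 / 2)) (- y).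
  by apply: is_derive_eq; rewrite /GRing.scale/=; field.
move=> de; have := (@is_derive1_comp _ expR (fun y : R => - (y ^+ 2 / 2)) _ _ _ de dq) => dc.
rewrite (_ : gauss = (normal_peak 1 : R) *: (expR \o (fun y => - (y ^+ 2 / 2)))); last first.
  by apply/funext => z; rewrite gaussE.
apply: is_derive_eq.
rewrite /gauss1 gaussE /GRing.scale/=; ring.
Qed.

Lemma is_derive_gauss1 y : is_derive y 1 gauss1 (gauss2 y).
Proof.
have dg := is_derive_gauss.
rewrite /gauss1; apply: is_derive_eq.
rewrite /gauss2 /gauss1 /GRing.scale/=; ring.
Qed.

(** From [expR t >= 1 + t] at [t = y ^+ 2 / 4], squared: enough decay to absorb
   polynomials of degree 4. *)
Lemma gauss_le y : gauss y * (1 + y ^+ 2 / 4) ^+ 2 <= 1.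
Proof.
have pk : normal_peak 1 <= 1 :> R.
  have pi1 : 1 <= pi *+ 2 :> R.
    by have := pi_ge2 R; rewrite -(mulr_natl pi); lra.
  have s1 : 1 <= Num.sqrt (pi *+ 2) :> R by rewrite -[X in X <= _]sqrtr1 ler_wsqrtr.
  by rewrite /normal_peak expr1n mul1r invf_le1// (lt_le_trans ltr01).
have e : expR (- (y ^+ 2 / 2)) * (1 + y ^+ 2 / 4) ^+ 2 <= 1.
  rewrite expRN mulrC ler_pdivrMr ?expR_gt0// mul1r.
  have -> : y ^+ 2 / 2 = 2%:R * (y ^+ 2 / 4) by field.
  rewrite expRM_natl lerXn2r ?nnegrE ?expR_ge0//; last exact: expR_ge1Dx.
  by rewrite addr_ge0// divr_ge0// sqr_ge0.
rewrite gaussE -mulrA; apply: le_trans pk; rewrite ler_piMr ?normal_peak_ge0//.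
Qed.

Lemma gauss_poly_bounds y :
  [/\ `|gauss y| <= 100, `|gauss1 y| <= 100, `|gauss2 y| <= 100 &
      `|y * gauss2 y| <= 100].
Proof.
have b (q : R) : `|q| <= 100 * (1 + y ^+ 2 / 4) ^+ 2 -> `|q * gauss y| <= 100.
  move=> qb; rewrite normrM [X in _ * X]ger0_norm ?gauss_ge0//.
  apply: le_trans (ler_wpM2r (gauss_ge0 y) qb) _.
  by rewrite -mulrA ler_piMr// mulrC gauss_le.
split.
- by rewrite -[gauss y]mul1r; apply: b; rewrite normr1; nra.
- by apply: b; rewrite ler_norml; apply/andP; split; nra.
- by apply: b; rewrite ler_norml; apply/andP; split; nra.
- by rewrite mulrA; apply: b; rewrite ler_norml; apply/andP; split; nra.
Qed.

End Gaussian.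

(** * Normal distribution functions *)

Section NormalCdf.
Variable R : realType.
Implicit Types x y s r h : R.

Definition normal_cdf s x : R := fine (normal_prob 0 s `]-oo, x]).

Lemma normal_cdf_ge0 s x : 0 <= normal_cdf s x.
Proof. by rewrite /normal_cdf fine_ge0. Qed.

Lemma normal_cdf_le1 s x : normal_cdf s x <= 1.
Proof.
rewrite /normal_cdf -[1]/(fine 1%E) fine_le//; first exact: fin_num_measure.
exact: probability_le1.
Qed.

Lemma normal_cdf_mono s x y : x <= y -> normal_cdf s x <= normal_cdf s y.
Proof.
move=> xy; rewrite /normal_cdf fine_le ?fin_num_measure//.
by rewrite le_measure ?inE//; apply: subset_itvl; rewrite bnd_simp.
Qed.

Lemma is_derive_normal_cdf s x : s != 0 ->
  is_derive x 1 (normal_cdf s) (normal_pdf 0 s x).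
Proof.
move=> s0.
have xx1 : x < x + 1 by rewrite ltrDl.
have ifs : lebesgue_measure.-integrable [set` Interval -oo%O (BRight (x + 1))]
    (EFin \o normal_pdf 0 s).
  by apply: integrableS (integrable_normal_pdf 0 s).
have [dF FE] := continuous_FTC1 xx1 ifs (ltNyr _) (@continuous_normal_pdf _ 0 _ s0 x).
apply: DeriveDef; first exact: dF.
by rewrite -FE derive1E.
Qed.

Let idR : measurableTypeR R -> R := id.
Let idR_meas : measurable_fun setT idR. Proof. exact: measurable_id. Qed.
HB.instance Definition _ := isMeasurableFun.Build _ _ _ _ idR idR_meas.

Lemma normal_cdf_cvgy s : normal_cdf s x @[x --> +oo] --> (1 : R).
Proof.
have := @cvg_cdfy1 _ _ R (normal_prob 0 s) (idR : {RV (normal_prob 0 s) >-> R}).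
exact: fine_cvg.
Qed.

Lemma normal_cdf_cvgNy s : normal_cdf s x @[x --> -oo] --> (0 : R).
Proof.
have := @cvg_cdfNy0 _ _ R (normal_prob 0 s) (idR : {RV (normal_prob 0 s) >-> R}).
exact: fine_cvg.
Qed.

(** Both sides have the same derivative and vanish at [-oo], which spares a change
   of variables in the integral. *)
Lemma normal_cdf_scale s x : 0 < s -> normal_cdf s x = normal_cdf 1 (x / s).
Proof.
move=> s0.
pose D y := normal_cdf s y - normal_cdf 1 (y / s).
have dD y : is_derive y 1 D 0.
  rewrite /D.
  have dq : is_derive y 1 (fun y => y / s) (s^-1).
    by apply: is_derive_eq; rewrite /GRing.scale/= mulr0 mulr1 add0r.
  have dc := @is_derive1_comp _ (normal_cdf 1) (fun y : R => y / s) _ _ _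
    (is_derive_normal_cdf (y / s) (oner_neq0 R)) dq.
  have dn := is_derive_normal_cdf y (lt0r_neq0 s0).
  apply: is_derive_eq.
  rewrite !normal_pdfE ?lt0r_neq0 ?oner_neq0// /normal_fun !subr0 /normal_peak.
  rewrite -[in X in X - _]mulrnAr sqrtrM ?sqr_ge0// sqrtr_sqr gtr0_norm//.
  have -> : - (y / s) ^+ 2 / (1 ^+ 2 *+ 2) = - y ^+ 2 / (s ^+ 2 *+ 2).
    by rewrite expr1n -[s ^+ 2 *+ 2]mulr_natl; field; rewrite lt0r_neq0.
  by rewrite expr1n mul1r invfM /GRing.scale/=; ring.
have Dc y : D y = D x by exact: is_derive_0_is_cst.
have c1 : D y @[y --> -oo] --> D x.
  by rewrite (_ : D = cst (D x)); [exact: cvg_cst|apply/funext => y; rewrite Dc].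
have c2 : D y @[y --> -oo] --> (0 - 0 : R).
  apply: cvgB; first exact: normal_cdf_cvgNy.
  apply: cvg_comp (normal_cdf_cvgNy 1).
  apply/gt0_cvgMlNy; last exact: cvg_id.
  by rewrite invr_gt0.
apply/eqP; rewrite -subr_eq0 -[X in _ == X]subr0; apply/eqP.
exact: cvg_unique c1 c2.
Qed.

End NormalCdf.

(** * The Gaussian solution of the heat equation *)

Section HeatFlow.
Variable R : realType.
Implicit Types x y s r h : R.

Definition heat s x : R := normal_cdf 1 (x / Num.sqrt s).
(** The second derivative of [heat s] in [x]. *)
Definition heat2 s x : R := s^-1 * gauss1 (x / Num.sqrt s).

Lemma is_derive_div_sqrt x s : 0 < s ->
  is_derive s 1 (fun t : R => x / Num.sqrt t) (- x / (2 * Num.sqrt s ^+ 3)).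
Proof.
move=> s0; have q0 : Num.sqrt s != 0 by rewrite gt_eqF// sqrtr_gt0.
have ds := is_derive1_sqrt s0.
have dV := is_deriveV q0 ds.
apply: (is_derive_eq (is_deriveZ x dV)).
by rewrite /GRing.scale/=; field.
Qed.

(** The heat equation, which lets a time step absorb second-order terms in space. *)
Lemma is_derive_heat x s : 0 < s ->
  is_derive s 1 (heat ^~ x) (heat2 s x / 2).
Proof.
move=> s0; have q0 : Num.sqrt s != 0 by rewrite gt_eqF// sqrtr_gt0.
have dq := is_derive_div_sqrt x s0.
have dc := @is_derive1_comp _ (normal_cdf 1) (fun t => x / Num.sqrt t) _ _ _
  (is_derive_normal_cdf _ (oner_neq0 R)) dq.
apply: is_derive_eq.
rewrite -/(gauss _) /heat2 /gauss1 /GRing.scale/= -[in RHS](sqr_sqrtr (ltW s0)).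
by rewrite sqrtr_sqr ger0_norm ?sqrtr_ge0//; field.
Qed.

(** The derivative of [heat2] in [s]. *)
Definition heat2_t s x : R :=
  - (gauss1 (x / Num.sqrt s) + (x / Num.sqrt s) * gauss2 (x / Num.sqrt s) / 2)
    / s ^+ 2.

Lemma is_derive_heat2 x s : 0 < s ->
  is_derive s 1 (heat2 ^~ x) (heat2_t s x).
Proof.
move=> s0; have q0 : Num.sqrt s != 0 by rewrite gt_eqF// sqrtr_gt0.
have dq := is_derive_div_sqrt x s0.
have dc := @is_derive1_comp _ (@gauss1 R) (fun t => x / Num.sqrt t) _ _ _
  (is_derive_gauss1 _) dq.
have dV := is_deriveV (lt0r_neq0 s0) (is_derive_id s (1 : R)).
have dM := is_deriveM dV dc.
apply: (is_derive_eq dM).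
rewrite /heat2_t /GRing.scale/=.
move: (gauss1 _) (gauss2 _) => u v.
rewrite -!exprVn -[s in LHS](sqr_sqrtr (ltW s0)) -[s in RHS](sqr_sqrtr (ltW s0)).
by rewrite sqrtr_sqr ger0_norm ?sqrtr_ge0//; field.
Qed.

(** The estimates needed for Lindeberg's method, with one constant for all
   [s >= d]. In [heat_taylor] the coefficient [c] of the linear term is left
   unspecified, since that term averages to zero along a martingale. *)
Record heat_regular (d C : R) : Prop := HeatRegular {
  heat_regular_ge0 : 0 <= C;
  heat_taylor : forall s x, d <= s -> exists c, forall h,
    `|heat s (x + h) - heat s x - h * c - h ^+ 2 / 2 * heat2 s x|
      <= C * `|h| ^+ 3;
  heat_lip : forall s x h, d <= s -> `|heat s (x + h) - heat s x| <= C * `|h|;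
  heat_step : forall s r x, d <= s -> 0 <= r ->
    `|heat (s + r) x - heat s x - r / 2 * heat2 s x| <= C * r ^+ 2;
  heat_lip_t : forall s r x, d <= s -> 0 <= r ->
    `|heat (s + r) x - heat s x| <= C * r;
  heat2_bound : forall s x, d <= s -> `|heat2 s x| <= C;
  heat2_lip : forall s x h, d <= s -> `|heat2 s (x + h) - heat2 s x| <= C * `|h|;
  heat2_lip_t : forall s r x, d <= s -> 0 <= r ->
    `|heat2 (s + r) x - heat2 s x| <= C * r
}.

(** With [a = 1 / sqrt s], every derivative involved is a power [a ^+ k], [k <= 4],
   times a bounded function of [x a]. *)
Lemma heat_regularity d : 0 < d -> exists C, heat_regular d C.
Proof.
move=> d0; pose b := (Num.sqrt d)^-1; pose C := 200 * (1 + b) ^+ 4.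
have b0 : 0 < b by rewrite invr_gt0 sqrtr_gt0.
have inv s : d <= s -> [/\ 0 < s, 0 < (Num.sqrt s)^-1, (Num.sqrt s)^-1 <= b &
    s^-1 = (Num.sqrt s)^-1 ^+ 2].
  move=> ds; have s0 := lt_le_trans d0 ds.
  rewrite invr_gt0 sqrtr_gt0 s0 lef_pV2 ?posrE ?sqrtr_gt0// ler_wsqrtr//.
  by rewrite exprVn sqr_sqrtr// ltW.
have bk (k : nat) (a : R) : 0 < a -> a <= b -> (k <= 4)%N -> a ^+ k <= (1 + b) ^+ 4.
  move=> a0 ab k4; apply: (@le_trans _ _ ((1 + b) ^+ k)).
    by rewrite lerXn2r ?nnegrE ?ltW//; lra.
  by rewrite ler_weXn2l// lerDl ltW.
have gb y := gauss_poly_bounds y.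
have C0 : 0 <= C by rewrite mulr_ge0// exprn_ge0// addr_ge0// ltW.
have mC (k : nat) (a c u : R) : 0 < a -> a <= b -> (k <= 4)%N -> 0 <= u -> c <= 200 ->
    c * (a ^+ k * u) <= C * u.
  move=> a0 ab k4 u0 c2; rewrite mulrA ler_wpM2r//.
  have ak : 0 <= a ^+ k by rewrite exprn_ge0// ltW.
  apply: le_trans (ler_wpM2r ak c2) _.
  by rewrite /C ler_wpM2l// bk.
have L2 s x h : d <= s -> `|heat2 s (x + h) - heat2 s x| <= C * `|h|.
  move=> /inv[s0 a0 ab sE]; rewrite /heat2 sE; move: (Num.sqrt s)^-1 a0 ab => a a0 ab.
  rewrite -mulrBr mulrDl normrM normrX (gtr0_norm a0).
  have := lipschitz_of_derive (@is_derive_gauss1 R) (C := 100) _ (x * a) (h * a).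
  move=> /(_ (fun y => let: And4 _ _ H _ := gb y in H)) H.
  have a2 : 0 <= a ^+ 2 by rewrite exprn_ge0// ltW.
  apply: le_trans (ler_wpM2l a2 H) _.
  rewrite normrM (gtr0_norm a0).
  have -> : a ^+ 2 * (100 * (`|h| * a)) = 100 * (a ^+ 3 * `|h|) by ring.
  by apply: mC => //; lra.
have B2 s x : d <= s -> `|heat2 s x| <= C.
  move=> /inv[s0 a0 ab sE]; rewrite /heat2 sE; move: (Num.sqrt s)^-1 a0 ab => a a0 ab.
  have [_ H _ _] := gb (x * a).
  rewrite normrM normrX (gtr0_norm a0) -[C]mulr1.
  have a2 : 0 <= a ^+ 2 by rewrite exprn_ge0// ltW.
  apply: le_trans (ler_wpM2l a2 H) _.
  have -> : a ^+ 2 * 100 = 100 * (a ^+ 2 * 1) by ring.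
  by apply: mC => //; lra.
have T2 s r x : d <= s -> 0 <= r -> `|heat2 (s + r) x - heat2 s x| <= C * r.
  move=> ds r0.
  have sr : s <= s + r by rewrite lerDl.
  have := @derive_bound_segment R (heat2 ^~ x) (heat2_t ^~ x) s (s + r) C sr.
  rewrite addrAC subrr add0r; apply.
    by move=> t /andP[st _]; apply: is_derive_heat2; apply: lt_le_trans st; apply: lt_le_trans ds.
  move=> t /andP[st _]; have [t0 a0 ab tE] := inv t (le_trans ds st).
  have t2 : t ^- 2 = (Num.sqrt t)^-1 ^+ 4 by rewrite -exprVn tE -exprM.
  rewrite /heat2_t t2; move: (Num.sqrt t)^-1 a0 ab => a a0 ab.
  have [_ H1 _ H2] := gb (x * a).
  rewrite normrM normrX (gtr0_norm a0) normrN -[C]mulr1.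
  have a2 : 0 <= a ^+ 4 by rewrite exprn_ge0// ltW.
  have H : `|gauss1 (x * a) + x * a * gauss2 (x * a) / 2| <= 200.
    apply: le_trans (ler_normD _ _) _.
    by rewrite [`|_ / 2|]normrM (@ger0_norm _ 2^-1) ?invr_ge0//; lra.
  apply: le_trans (ler_wpM2r a2 H) _.
  by rewrite -[a ^+ 4]mulr1; apply: mC.
have T1 s r x : d <= s -> 0 <= r ->
    `|heat (s + r) x - heat s x - r / 2 * heat2 s x| <= C * r ^+ 2.
  move=> ds r0.
  have sr : s <= s + r by rewrite lerDl.
  have := @derive_bound_segment R (fun t => heat t x - (t - s) / 2 * heat2 s x)
    (fun t => heat2 t x / 2 - heat2 s x / 2) s (s + r) (C * r) sr.
  have srs : s + r - s = r by ring.
  rewrite subrr !mul0r subr0 srs -[C * r * r]mulrA -expr2 addrAC.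
  apply => t /andP[st tsr].
    have t0 : 0 < t by apply: lt_le_trans st; apply: lt_le_trans ds.
    apply: is_deriveB; first exact: is_derive_heat.
    by apply: is_derive_eq; rewrite /GRing.scale/=; field.
  have ts0 : 0 <= t - s by rewrite subr_ge0.
  have := T2 s (t - s) x ds ts0; have -> : s + (t - s) = t by ring.
  move=> H.
  rewrite -mulrBl [`|_ / 2|]normrM (@ger0_norm _ 2^-1) ?invr_ge0//.
  have : C * (t - s) <= C * r by rewrite ler_wpM2l// lerBlDl.
  by have := normr_ge0 (heat2 t x - heat2 s x); lra.
exists C; split=> //.
- move=> s x /inv[s0 a0 ab sE]; exists (gauss (x / Num.sqrt s) / Num.sqrt s) => h.
  rewrite /heat /heat2 sE; move: (Num.sqrt s)^-1 a0 ab => a a0 ab.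
  have := @taylor2_bound R (normal_cdf 1) (@gauss R) (@gauss1 R) 100
    (fun y => is_derive_normal_cdf y (oner_neq0 R)) (@is_derive_gauss R) _ (x * a) (h * a).
  have L := lipschitz_of_derive (@is_derive_gauss1 R) (C := 100).
  move=> /(_ (L (fun y => let: And4 _ _ H _ := gb y in H))) H.
  rewrite mulrDl.
  have -> : normal_cdf 1 (x * a + h * a) - normal_cdf 1 (x * a) -
     h * (gauss (x * a) * a) - h ^+ 2 / 2 * (a ^+ 2 * gauss1 (x * a)) =
     normal_cdf 1 (x * a + h * a) - normal_cdf 1 (x * a) -
     h * a * gauss (x * a) - (h * a) ^+ 2 / 2 * gauss1 (x * a) by ring.
  apply: le_trans H _; rewrite normrM (gtr0_norm a0) exprMn [_ * a ^+ 3]mulrC.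
  by apply: mC; rewrite ?exprn_ge0 ?ler_nat.
- move=> s x h /inv[s0 a0 ab sE]; rewrite /heat; move: (Num.sqrt s)^-1 a0 ab => a a0 ab.
  have := lipschitz_of_derive (fun y => is_derive_normal_cdf y (oner_neq0 R))
     (C := 100) _ (x * a) (h * a).
  move=> /(_ (fun y => let: And4 H _ _ _ := gb y in H)) H.
  rewrite mulrDl; apply: le_trans H _; rewrite normrM (gtr0_norm a0).
  have -> : 100 * (`|h| * a) = 100 * (a ^+ 1 * `|h|) by ring.
  by apply: mC => //; lra.
- move=> s r x ds r0.
  have sr : s <= s + r by rewrite lerDl.
  have := @derive_bound_segment R (heat ^~ x) (fun t => heat2 t x / 2) s (s + r) C sr.
  rewrite addrAC subrr add0r; apply.
    by move=> t /andP[st _]; apply: is_derive_heat; apply: lt_le_trans st; apply: lt_le_trans ds.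
  move=> t /andP[st _]; have := B2 t x (le_trans ds st).
  by rewrite [`|_ / 2|]normrM (@ger0_norm _ 2^-1) ?invr_ge0//; have := normr_ge0 (heat2 t x); lra.
Qed.

End HeatFlow.

(** * Ergodicity and the Poisson equation *)

Section FiniteBounds.
Variable R : realType.

Lemma finite_bounded (I : finType) (f : I -> R) :
  exists2 C, 0 <= C & forall i, `|f i| <= C.
Proof.
exists (\sum_i `|f i|); first exact: sumr_ge0.
by move=> i; rewrite (bigD1 i)//= lerDl sumr_ge0.
Qed.

Lemma finite_positive_lbound (I : finType) (f : I -> R) :
  (forall i, 0 < f i) -> exists2 e, 0 < e & forall i, e <= f i.
Proof.
move=> f0; have [C C0 Cf] := finite_bounded (fun i => (f i)^-1).
exists (C + 1)^-1; first by rewrite invr_gt0 ltr_wpDl.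
move=> i; rewrite invf_ple ?posrE// ?ltr_wpDl//.
by rewrite (le_trans (ler_norm _))// (le_trans (Cf i))// lerDl.
Qed.

End FiniteBounds.

(** A numerical semigroup with gcd 1 contains all large integers. The least
   positive difference [d] of two of its elements divides every element [s]:
   otherwise [d - s %% d] would be a smaller positive difference. Hence [d = 1],
   and two consecutive elements generate everything from some point on. *)
Lemma additive_gcd1_cofinite (S : pred nat) :
  S 0%N -> (forall m n, S m -> S n -> S (m + n)%N) ->
  (forall d, (forall n, (0 < n)%N -> S n -> (d %| n)%N) -> d = 1%N) ->
  exists N, forall n, (N <= n)%N -> S n.
Proof.
move=> S0 SD Sgcd.
have SM k a : S a -> S (k * a)%N.
  by move=> Sa; elim: k => // k IH; rewrite mulSn SD.
pose D d := `[< (0 < d)%N /\ exists2 a, S a & S (a + d)%N >].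
have exD : exists d, D d.
  apply: contrapT => nD; suff : 2%N = 1%N by [].
  apply: Sgcd => n n0 Sn; exfalso; apply: nD; exists n.
  by apply/asboolP; split=> //; exists 0%N.
case: (ex_minnP exD) => d /asboolP[d0 [a Sa Sad]] dmin.
have d1 : d = 1%N.
  apply: Sgcd => s _ Ss; apply: contrapT => /negP; rewrite /dvdn -lt0n => r0.
  have rd : (s %% d < d)%N by rewrite ltn_mod.
  suff : (d <= d - s %% d)%N by rewrite leqNgt ltn_subrL r0 d0.
  apply: dmin; apply/asboolP; split; first by rewrite subn_gt0.
  exists (s + (s %/ d).+1 * a)%N; first exact: SD (SM _ _ _).
  suff -> : (s + (s %/ d).+1 * a + (d - s %% d) = (s %/ d).+1 * (a + d))%N.
    exact: SM.
  rewrite {1}(divn_eq s d) mulnDr.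
  suff : ((s %% d) + (d - s %% d) = d)%N by rewrite mulSn; lia.
  by rewrite subnKC// ltnW.
rewrite {}d1 addn1 in Sad.
have [a0|a0] := posnP a.
  by exists 0%N => n _; rewrite -[n]muln1; apply: SM; rewrite -[1%N]/(0.+1) -a0.
exists (a * a)%N => n an.
have aq : (a <= n %/ a)%N by rewrite leq_divRL.
have rq : (n %% a <= n %/ a)%N by apply: leq_trans aq; rewrite ltnW// ltn_mod.
suff -> : n = ((n %/ a - n %% a) * a + (n %% a) * a.+1)%N by apply: SD; exact: SM.
rewrite mulnBl mulnS addnCA addnC subnK ?leq_mul2r ?rq ?orbT//.
by rewrite -divn_eq.
Qed.

Section Ergodic.
Variables (R : realType) (L : finType) (Q : L -> L -> R) (p : L -> R).
Implicit Types (h f u v : L -> R) (x y z : L).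

Definition transition h : L -> R := fun z => \sum_z' Q z z' * h z'.
Definition rmean h : R := \sum_z p z * h z.

Lemma transition_ext h1 h2 : h1 =1 h2 -> transition h1 =1 transition h2.
Proof. by move=> e z; apply: eq_bigr => y _; rewrite e. Qed.

Hypothesis Q_trans : is_transition_function Q.

Let Q_ge0 x y : 0 <= Q x y. Proof. by case: (Q_trans x). Qed.
Let Q_sum1 x : \sum_y Q x y = 1. Proof. by case: (Q_trans x). Qed.

Lemma transition_cst c : transition (fun=> c) =1 (fun=> c).
Proof. by move=> x; rewrite /transition -mulr_suml Q_sum1 mul1r. Qed.

Lemma transition_norm_le h C : (forall z, `|h z| <= C) ->
  forall z, `|transition h z| <= C.
Proof.
move=> hC z; rewrite /transition (le_trans (ler_norm_sum _ _ _))//.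
rewrite -[leRHS](transition_cst C z) ler_sum// => y _.
by rewrite normrM ger0_norm// ler_wpM2l.
Qed.

Lemma transition_power_ge0 n x y : 0 <= transition_power Q n x y.
Proof. by elim: n x => //= n IH x; apply: sumr_ge0 => z _; rewrite mulr_ge0. Qed.

Lemma iter_transitionE n h x :
  iter n transition h x = \sum_y transition_power Q n x y * h y.
Proof.
elim: n x => [|n IH] x /=.
  rewrite (bigD1 x)//= eqxx mul1r big1 ?addr0// => y /negPf.
  by rewrite eq_sym => ->; rewrite mul0r.
rewrite [LHS](eq_bigr (fun z => \sum_y Q x z * (transition_power Q n z y * h y)));
  last by move=> z _; rewrite IH mulr_sumr.
rewrite exchange_big/=; apply: eq_bigr => y _.
by rewrite mulr_suml; apply: eq_bigr => z _; rewrite mulrA.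
Qed.

Lemma transition_power_sum1 n x : \sum_y transition_power Q n x y = 1.
Proof.
transitivity (iter n transition (fun=> 1) x).
  by rewrite iter_transitionE; apply: eq_bigr => y _; rewrite mulr1.
elim: n x => //= n IH x.
by rewrite (transition_ext IH) transition_cst.
Qed.

Lemma transition_powerD m n x y : transition_power Q (m + n) x y =
  \sum_z transition_power Q m x z * transition_power Q n z y.
Proof.
elim: m x => [|m IH] x /=.
  rewrite add0n (bigD1 x)//= eqxx mul1r big1 ?addr0// => z /negPf.
  by rewrite eq_sym => ->; rewrite mul0r.
under eq_bigr do rewrite IH mulr_sumr.
rewrite exchange_big/=; apply: eq_bigr => z _.
by rewrite mulr_suml; apply: eq_bigr => t _; rewrite mulrA.
Qed.

Lemma transition_powerD_gt0 m n x y z :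
  0 < transition_power Q m x y -> 0 < transition_power Q n y z ->
  0 < transition_power Q (m + n) x z.
Proof.
move=> xy yz; rewrite transition_powerD (bigD1 y)//=.
rewrite ltr_pwDl ?mulr_gt0// sumr_ge0// => t _.
by rewrite mulr_ge0 ?transition_power_ge0.
Qed.

Hypothesis Q_irr : irreducible_transition Q.
Hypothesis Q_aper : aperiodic_transition Q.

(** The return times to [x] form an additive semigroup with gcd 1, hence contain
   all large integers; a path from [x] to [y] then has any large length. *)
Lemma transition_power_eventually_gt0 :
  exists N, forall x y, 0 < transition_power Q N x y.
Proof.
have [f fP] : {f : L * L -> nat & forall xy n, (f xy <= n)%N ->
    0 < transition_power Q n xy.1 xy.2}.
  apply: (@choice _ _ (fun xy (N : nat) => forall n, (N <= n)%N ->
    0 < transition_power Q n xy.1 xy.2)) => -[x y] /=.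
  have [k xy] := Q_irr x y.
  have [|||N NP] := @additive_gcd1_cofinite (fun n => 0 < transition_power Q n x x).
  - by rewrite /= eqxx.
  - by move=> m n; exact: transition_powerD_gt0.
  - exact: Q_aper.
  exists (N + k)%N => n Nn.
  rewrite -(@subnK k n); last by rewrite (leq_trans _ Nn)// leq_addl.
  apply: transition_powerD_gt0 xy; apply: NP.
  by rewrite leq_subRL 1?addnC// (leq_trans _ Nn)// leq_addl.
exists (\max_xy f xy) => x y; apply: (fP (x, y)).
exact: (leq_bigmax (x, y)).
Qed.

Hypothesis p_stat : is_stationary p Q.

Let p_ge0 z : 0 <= p z. Proof. by case: p_stat => -[]. Qed.
Let p_sum1 : \sum_z p z = 1. Proof. by case: p_stat => -[]. Qed.

Lemma rmean_cst c : rmean (fun=> c) = c.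
Proof. by rewrite /rmean -mulr_suml p_sum1 mul1r. Qed.

Lemma rmeanB f g : rmean (fun z => f z - g z) = rmean f - rmean g.
Proof. by rewrite /rmean -sumrB; apply: eq_bigr => z _; rewrite mulrBr. Qed.

Lemma rmean_transition h : rmean (transition h) = rmean h.
Proof.
rewrite /rmean /transition; under eq_bigr do rewrite mulr_sumr.
rewrite exchange_big/=; apply: eq_bigr => y _.
case: p_stat => _ <-; rewrite mulr_suml.
by apply: eq_bigr => z _; rewrite mulrA.
Qed.

Lemma rmean_itv h a b : (forall z, a <= h z <= b) -> a <= rmean h <= b.
Proof.
move=> hab; apply/andP; split; [rewrite -[leLHS](rmean_cst a)|rewrite -[leRHS](rmean_cst b)];
  apply: ler_sum => z _; case/andP: (hab z) => *; by rewrite ler_wpM2l.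
Qed.

Lemma transition_itv h a b : (forall z, a <= h z <= b) ->
  forall z, a <= transition h z <= b.
Proof.
move=> hab z; apply/andP; split;
  [rewrite -[leLHS](transition_cst a z)|rewrite -[leRHS](transition_cst b z)];
  apply: ler_sum => y _; case/andP: (hab y) => *; by rewrite ler_wpM2l.
Qed.

(** If all entries of [Q^N] are at least [e], every value of [Q^N h] gives weight
   at least [e] to the value of [h] at one fixed state [x0]. *)
Lemma doeblin_contraction : exists N, exists2 c, 0 <= c < 1 &
  forall h a b, (forall z, a <= h z <= b) ->
    exists a' b', b' - a' = c * (b - a) /\
      forall z, a' <= iter N transition h z <= b'.
Proof.
have [N Npos] := transition_power_eventually_gt0.
have [e e0 eP] := finite_positive_lbound
  (fun xy : L * L => Npos xy.1 xy.2).
have [x0 _] : exists x0 : L, True.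
  apply: contrapT => nL; have := p_sum1; rewrite big1 => [/eqP|z _].
    by rewrite eq_sym oner_eq0.
  by exfalso; apply: nL; exists z.
have e1 : e <= 1.
  apply: le_trans (eP (x0, x0)) _; rewrite -(transition_power_sum1 N x0)/=.
  by rewrite (bigD1 x0)//= lerDl sumr_ge0// => y _; exact: transition_power_ge0.
exists N, (1 - e); first by rewrite subr_ge0 e1/= ltrBlDr ltrDl.
move=> h a b hab.
(* Both bounds move towards [h x0]. *)
exists (a + e * (h x0 - a)), (b - e * (b - h x0)); split; first by ring.
move=> z; rewrite iter_transitionE.
have hx k : \sum_y transition_power Q N z y * h y =
    k + \sum_y transition_power Q N z y * (h y - k).
  under [in RHS]eq_bigr do rewrite mulrBr.
  by rewrite sumrB -mulr_suml transition_power_sum1 mul1r addrC subrK.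
apply/andP; split.
  rewrite (hx a) lerD2l (bigD1 x0)//=; apply: ler_wpDr.
    apply: sumr_ge0 => y _; rewrite mulr_ge0 ?transition_power_ge0 ?subr_ge0//.
    by case/andP: (hab y).
  rewrite ler_wpM2r ?subr_ge0//; first by case/andP: (hab x0).
  exact: (eP (z, x0)).
rewrite (hx b) lerD2l -[leLHS]opprK lerN2 -sumrN (bigD1 x0)//= -mulrN opprB.
apply: ler_wpDr.
  apply: sumr_ge0 => y _; rewrite -mulrN opprB.
  rewrite mulr_ge0 ?transition_power_ge0 ?subr_ge0//.
  by case/andP: (hab y).
rewrite ler_wpM2r ?subr_ge0//; first by case/andP: (hab x0).
exact: (eP (z, x0)).
Qed.

(** The oscillation of [Q^n h] decreases geometrically, and the mean of [h] always
   lies between the extreme values of [Q^n h]. *)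
Lemma ergodic_convergence h e : 0 < e -> exists K, forall n z, (K <= n)%N ->
  `|iter n transition h z - rmean h| <= e.
Proof.
move=> e0; have [N [c /andP[c0 c1] cP]] := doeblin_contraction.
have [C C0 hC] := finite_bounded h.
have osc m : exists a b, b - a <= c ^+ m * (2 * C) /\
    forall z, a <= iter (m * N) transition h z <= b.
  elim: m => [|m [a [b [ba abP]]]].
    exists (- C), C; split; first by rewrite expr0 mul1r; lra.
    by move=> z; rewrite -ler_norml.
  have [a' [b' [ba' abP']]] := cP _ _ _ abP.
  exists a', b'; split; first by rewrite ba' exprS -mulrA ler_wpM2l.
  by move=> z; rewrite mulSn iterD.
have [m mP] : exists m, c ^+ m * (2 * C) <= e.
  have c_lt1 : `|c| < 1 by rewrite ger0_norm.
  have /cvgrPdist_le/(_ (e / (2 * C + 1))) := @cvg_expr R c c_lt1.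
  have C1 : 0 < 2 * C + 1 by lra.
  case=> [|m _ /(_ m (leqnn m))]; first by rewrite divr_gt0.
  rewrite /= sub0r normrN ger0_norm ?exprn_ge0// => cm; exists m.
  apply: (@le_trans _ _ (e / (2 * C + 1) * (2 * C))).
    by rewrite ler_wpM2r//; lra.
  by rewrite mulrAC ler_pdivrMr// ler_wpM2l// ?ltW//; lra.
have [a [b [ba abP]]] := osc m.
exists (m * N)%N => n z Kn.
have abn y : a <= iter n transition h y <= b.
  rewrite -(subnK Kn) iterD; elim: (n - m * N)%N y => //= k IH y.
  exact: transition_itv.
have -> : rmean h = rmean (iter n transition h).
  by elim: (n) => //= k ->; rewrite rmean_transition.
have /andP[m1 m2] := rmean_itv abn; have /andP[z1 z2] := abn z.
by rewrite ler_norml; apply/andP; split; lra.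
Qed.

Lemma harmonic_cst v : (forall z, transition v z = v z) -> forall z, v z = rmean v.
Proof.
move=> vh z; apply/eqP; rewrite -subr_eq0 -normr_eq0; apply/eqP.
apply/eqP; rewrite eq_le normr_ge0 andbT; apply/ler_addgt0Pl => e e0.
have [K KP] := ergodic_convergence v e0; have := KP K z (leqnn K).
have vK y : iter K transition v y = v y.
  by elim: K {KP} y => //= k IH y; rewrite (transition_ext IH).
by rewrite vK addr0.
Qed.

(** The operator [u |-> u - Q u + E_p u] preserves the mean, and its kernel consists
   of harmonic functions of mean zero, that is, of 0. In finite dimension it is
   therefore onto, and a preimage of [f] has mean zero like [f]. *)
Lemma poisson_exists f : rmean f = 0 ->
  exists2 u, rmean u = 0 & forall z, u z - transition u z = f z.
Proof.
move=> f0.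
pose F (u : {ffun L -> R^o}) : {ffun L -> R^o} :=
  [ffun z => u z - transition u z + rmean u].
have linF : linear F.
  move=> a u v; apply/ffunP => z; rewrite !ffunE /GRing.scale/=.
  have tl : transition (a *: u + v) z = a * transition u z + transition v z.
    rewrite /transition mulr_sumr -big_split/=; apply: eq_bigr => y _.
    by rewrite !ffunE /GRing.scale/=; ring.
  have ml : rmean (a *: u + v) = a * rmean u + rmean v.
    rewrite /rmean mulr_sumr -big_split/=; apply: eq_bigr => y _.
    by rewrite !ffunE /GRing.scale/=; ring.
  by rewrite tl ml; ring.
pose FL : {linear {ffun L -> R^o} -> {ffun L -> R^o}} :=
  HB.pack F (GRing.isLinear.Build _ _ _ _ F linF).
have Fmean (u : {ffun L -> R^o}) : rmean (F u) = rmean u.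
  rewrite /rmean -/(rmean u).
  under eq_bigr do rewrite ffunE mulrDr.
  rewrite big_split/= -/(rmean (fun z => u z - transition u z)) rmeanB.
  by rewrite rmean_transition subrr add0r -mulr_suml p_sum1 mul1r.
have ker0 : lker (linfun FL) == 0%VS.
  apply/lker0P => u v; rewrite !lfunE => uv.
  apply/eqP; rewrite -subr_eq0; apply/eqP.
  have F0 : F (u - v) = 0 by have := linearB FL u v; rewrite uv subrr.
  have m0 : rmean (u - v) = 0.
    rewrite -Fmean F0 /rmean big1// => z _; by rewrite ffunE mulr0.
  apply/ffunP => z; rewrite [in RHS]ffunE -m0; apply: harmonic_cst => {}z.
  have := congr1 (fun w : {ffun L -> R^o} => w z) F0.
  rewrite [in LHS]ffunE m0 addr0 [RHS]ffunE => /eqP.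
  by rewrite subr_eq0 => /eqP <-.
pose u := ((linfun FL)^-1%VF [ffun z => f z]).
have Fu : F u = [ffun z => f z].
  have := lker0_lfunVK ker0 [ffun z => f z].
  by rewrite lfunE.
have mu0 : rmean u = 0.
  rewrite -Fmean Fu -f0; by apply: eq_bigr => z _; rewrite ffunE.
exists u => // z.
have := congr1 (fun w : {ffun L -> R^o} => w z) Fu.
by rewrite [in LHS]ffunE [RHS]ffunE mu0 addr0.
Qed.

End Ergodic.

(** * Expectations over finite paths *)

Section PathSpace.
Variable L : finType.

(** Paths [(Z_0, ..., Z_n)] as left-nested pairs: one step of the chain is then a
   cartesian product with [L], with no arithmetic on lengths. *)
Fixpoint path_space (n : nat) : finType :=
  if n is m.+1 then (path_space m * L)%type else L.

Definition last_state (n : nat) : path_space n -> L :=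
  match n with 0%N => id | m.+1 => snd end.

Fixpoint path_sum (V : nmodType) (f : L -> V) (n : nat) : path_space n -> V :=
  match n with
  | 0%N => f
  | m.+1 => fun p => path_sum f p.1 + f p.2
  end.

End PathSpace.

Section PathExpectation.
Variables (R : realType) (L : finType) (Q : L -> L -> R) (mu : L -> R).

Fixpoint path_weight (n : nat) : path_space L n -> R :=
  match n with
  | 0%N => mu
  | m.+1 => fun p => path_weight p.1 * Q (last_state p.1) p.2
  end.

Definition path_mean (n : nat) (F : path_space L n -> R) : R :=
  \sum_p path_weight p * F p.

Hypothesis Q_trans : is_transition_function Q.
Hypothesis mu_distr : is_distribution mu.

Lemma path_weight_ge0 n (p : path_space L n) : 0 <= path_weight p.
Proof.
elim: n p => [|n IH] p /=; first by case: mu_distr.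
by rewrite mulr_ge0//; case: (Q_trans (last_state p.1)).
Qed.

(** The Markov property: conditioning on all but the last state. *)
Lemma path_mean_step n (F : path_space L n.+1 -> R) :
  path_mean F = path_mean (fun q => \sum_z Q (last_state q) z * F (q, z)).
Proof.
rewrite /path_mean.
rewrite (eq_bigr (fun p : path_space L n * L => path_weight p.1 *
   (Q (last_state p.1) p.2 * F (p.1, p.2)))); last by case=> q z _ /=; rewrite mulrA.
rewrite -(pair_bigA _ (fun q z => path_weight q * (Q (last_state q) z * F (q, z))))/=.
by apply: eq_bigr => q _; rewrite mulr_sumr.
Qed.

Lemma path_meanD n (F G : path_space L n -> R) :
  path_mean (fun p => F p + G p) = path_mean F + path_mean G.
Proof. by rewrite /path_mean -big_split; apply: eq_bigr => p _; rewrite mulrDr. Qed.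

Lemma path_meanZ n a (F : path_space L n -> R) :
  path_mean (fun p => a * F p) = a * path_mean F.
Proof. by rewrite /path_mean mulr_sumr; apply: eq_bigr => p _; rewrite mulrCA. Qed.

Lemma path_meanB n (F G : path_space L n -> R) :
  path_mean (fun p => F p - G p) = path_mean F - path_mean G.
Proof. by rewrite /path_mean -sumrB; apply: eq_bigr => p _; rewrite mulrBr. Qed.

Lemma path_mean_ext n (F G : path_space L n -> R) :
  F =1 G -> path_mean F = path_mean G.
Proof. by move=> e; apply: eq_bigr => p _; rewrite e. Qed.

Lemma path_mean_le n (F G : path_space L n -> R) :
  (forall p, F p <= G p) -> path_mean F <= path_mean G.
Proof. by move=> FG; apply: ler_sum => p _; rewrite ler_wpM2l ?path_weight_ge0. Qed.

Lemma path_weight_sum1 n : \sum_(p : path_space L n) path_weight p = 1.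
Proof.
elim: n => [|n IH] /=; first by case: mu_distr.
rewrite -(pair_bigA _ (fun q z => path_weight q * Q (last_state q) z))/= -IH.
by apply: eq_bigr => q _; rewrite -mulr_sumr; case: (Q_trans (last_state q)) => _ ->; rewrite mulr1.
Qed.

Lemma path_mean_cst n c : path_mean (fun _ : path_space L n => c) = c.
Proof. by rewrite /path_mean -mulr_suml path_weight_sum1 mul1r. Qed.

Lemma path_mean_dist n (F G : path_space L n -> R) c :
  (forall p, `|F p - G p| <= c) -> `|path_mean F - path_mean G| <= c.
Proof.
move=> FG; rewrite -path_meanB ler_norml; apply/andP; split.
  rewrite -(path_mean_cst n (- c)); apply: path_mean_le => p.
  by have := FG p; rewrite ler_norml => /andP[].
rewrite -[leRHS](path_mean_cst n); apply: path_mean_le => p.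
by have := FG p; rewrite ler_norml => /andP[].
Qed.

End PathExpectation.


(** * The martingale of the Poisson equation *)

Section Martingale.
Variables (R : realType) (L : finType) (Q : L -> L -> R) (mu : L -> R).
Hypothesis Q_trans : is_transition_function Q.
Hypothesis mu_distr : is_distribution mu.
Variable u : L -> R.

Let T := transition Q.
Let Ex n := @path_mean R L Q mu n.
Let Q_ge0 x y : 0 <= Q x y. Proof. by case: (Q_trans x). Qed.
Let Q_sum1 x : \sum_y Q x y = 1. Proof. by case: (Q_trans x). Qed.

(** [u(Z_(n+1)) - E(u(Z_(n+1)) | Z_n)] on the event [Z_n = z, Z_(n+1) = z']. *)
Definition increment (z z' : L) : R := u z' - transition Q u z.

Fixpoint martingale (n : nat) : path_space L n -> R :=
  match n with
  | 0%N => u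
  | m.+1 => fun q => martingale q.1 + increment (last_state q.1) q.2
  end.

Definition increment_variance (z : L) : R :=
  \sum_z' Q z z' * increment z z' ^+ 2.

Lemma transition_le (F : L -> R) c x :
  (forall z, F z <= c) -> \sum_z Q x z * F z <= c.
Proof.
move=> Fc; rewrite -[leRHS]mul1r -(Q_sum1 x) mulr_suml ler_sum// => z _.
by rewrite ler_wpM2l.
Qed.

Lemma increment_centered z : \sum_z' Q z z' * increment z z' = 0.
Proof.
rewrite /increment; under eq_bigr do rewrite mulrBr.
by rewrite sumrB -mulr_suml Q_sum1 mul1r subrr.
Qed.

Lemma path_sum_martingale f : (forall z, u z - transition Q u z = f z) ->
  forall n (q : path_space L n),
    path_sum f q = martingale q - transition Q u (last_state q).
Proof.
move=> uf; elim=> [|n IH] q /=; first by rewrite -uf.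
by rewrite IH -uf /increment; ring.
Qed.

Variable U : R.
Hypothesis U_ge0 : 0 <= U.
Hypothesis u_le : forall z, `|u z| <= U.

Lemma increment_le z z' : `|increment z z'| <= 2 * U.
Proof.
rewrite (le_trans (ler_normB _ _))//.
by have := transition_norm_le Q_trans u_le z; have := u_le z'; lra.
Qed.

(** Orthogonality of martingale increments. *)
Lemma martingale_second_moment n :
  Ex (fun q : path_space L n => martingale q ^+ 2) <= (2 * U) ^+ 2 * n.+1%:R.
Proof.
have sq (x B : R) : `|x| <= B -> x ^+ 2 <= B ^+ 2.
  by move=> xB; rewrite -real_normK ?num_real// lerXn2r// nnegrE (le_trans _ xB).
elim: n => [|n IH].
  rewrite mulr1 -[leRHS](path_mean_cst Q_trans mu_distr 0).
  apply: path_mean_le => // z; apply: sq => /=.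
  by apply: le_trans (u_le z) _; have := U_ge0; lra.
rewrite /Ex path_mean_step -[n.+2%:R]natr1 mulrDr mulr1.
apply: le_trans _ (lerD IH (lexx _)).
rewrite -[X in _ + X](path_mean_cst Q_trans mu_distr n) -path_meanD.
apply: path_mean_le => // q /=.
have -> : \sum_z Q (last_state q) z * (martingale q + increment (last_state q) z) ^+ 2
    = martingale q ^+ 2 * (\sum_z Q (last_state q) z) +
      2 * martingale q * (\sum_z Q (last_state q) z * increment (last_state q) z) +
      \sum_z Q (last_state q) z * increment (last_state q) z ^+ 2.
  by rewrite !mulr_sumr -!big_split; apply: eq_bigr => z _ /=; ring.
rewrite Q_sum1 increment_centered mulr1 mulr0 addr0 lerD2l.
by apply: transition_le => z; apply: sq; exact: increment_le.
Qed.

(** Averaging out the last step turns the weight [t] into [Q t] at the cost of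
   ignoring that step in the argument of [f], which moves by at most [2 * U]. *)
Lemma forget_final_weight (A l : R) (f : R -> R) (t : L -> R) n k :
  (forall z, `|t z| <= A) ->
  (forall x h, `|f (x + h) - f x| <= l * `|h|) ->
  `|Ex (fun q : path_space L (k + n) => t (last_state q) * f (martingale q)) -
    Ex (fun q : path_space L n =>
          iter k T t (last_state q) * f (martingale q))|
  <= k%:R * (A * (l * (2 * U))).
Proof.
move=> + fl; elim: k t => [|k IH] t tA; first by rewrite subrr normr0 mul0r.
have l0 : 0 <= l by have := fl 0 1; rewrite normr1 mulr1; exact: le_trans.
have := IH (T t) (transition_norm_le Q_trans tA); rewrite -iterSr => H.
rewrite -[k.+1%:R]natr1 mulrDl mul1r [leRHS]addrC.
apply: le_trans (ler_distD _ _ _) (lerD _ H).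
rewrite [X in `|X - _|]path_mean_step; apply: path_mean_dist => // q /=.
rewrite /T /transition mulr_suml -sumrB (le_trans (ler_norm_sum _ _ _))//.
rewrite (eq_bigr (fun z => Q (last_state q) z * (`|t z| *
  `|f (martingale q + increment (last_state q) z) - f (martingale q)|))); last first.
  by move=> z _; rewrite -!mulrA -!mulrBr !normrM (ger0_norm (Q_ge0 _ _)).
apply: transition_le => z.
rewrite ler_pM// (le_trans (fl _ _))// ler_wpM2l//.
exact: increment_le.
Qed.

End Martingale.

(** * Lindeberg's method *)

Section Lindeberg.
Variables (R : realType) (L : finType) (Q : L -> L -> R) (mu p : L -> R).
Hypothesis Q_trans : is_transition_function Q.
Hypothesis p_stat : is_stationary p Q.
Hypothesis mu_distr : is_distribution mu.
Variable u : L -> R.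

Let T := transition Q.
Let Ex n := @path_mean R L Q mu n.
Let D := increment Q u.
Let V := increment_variance Q u.
Let Q_ge0 x y : 0 <= Q x y. Proof. by case: (Q_trans x). Qed.
Let Q_sum1 x : \sum_y Q x y = 1. Proof. by case: (Q_trans x). Qed.

Lemma increment_variance_ge0 z : 0 <= V z.
Proof. by apply: sumr_ge0 => z' _; rewrite mulr_ge0 ?sqr_ge0. Qed.

Lemma mean_variance_ge0 : 0 <= rmean p V.
Proof.
apply: sumr_ge0 => z _; rewrite mulr_ge0 ?increment_variance_ge0//.
by case: p_stat => -[].
Qed.

Variables (w : L -> R) (U W d C : R).
Hypothesis w_poisson : forall z, w z - T w z = V z - rmean p V.
Hypothesis U_ge0 : 0 <= U.
Hypothesis W_ge0 : 0 <= W.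
Hypothesis u_le : forall z, `|u z| <= U.
Hypothesis w_le : forall z, `|w z| <= W.
Hypothesis heatC : heat_regular d C.

Let S := rmean p V.
Let S_ge0 : 0 <= S. Proof. exact: mean_variance_ge0. Qed.
Let C_ge0 : 0 <= C. Proof. exact: heat_regular_ge0 heatC. Qed.

(** The second term is a corrector: as [w - Q w = V - S], its conditional change in
   one step cancels the fluctuation of the conditional variance [V] around [S]. *)
Definition corrected_heat (l y s x : R) (z : L) : R :=
  heat s (y - l * x) + l ^+ 2 / 2 * heat2 s (y - l * x) * w z.

Let K1 := C * ((2 * U) ^+ 3 + (2 * U) * W + S ^+ 2 + S * W).

Lemma norm_half_sqr (l a b : R) :
  `|l ^+ 2 / 2 * a * b| = l ^+ 2 / 2 * `|a| * `|b|.
Proof.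
by rewrite normrM [`|_ * a|]normrM ger0_norm// divr_ge0// sqr_ge0.
Qed.

(** One step at scale [l] against an increase of the time by [S * l ^+ 2]. All
   contributions of order at most [l ^+ 2] cancel: order 1 as the increments are
   centred, order 2 by the heat equation and the choice of [w]. *)
Lemma corrected_heat_step l y s m z : 0 <= l <= 1 -> d <= s ->
  `|\sum_z' Q z z' * corrected_heat l y s (m + D z z') z' -
    corrected_heat l y (s + S * l ^+ 2) m z| <= K1 * l ^+ 3.
Proof.
move=> /andP[l0 l1] ds; rewrite /corrected_heat.
set x := y - l * m; set r := S * l ^+ 2.
have r0 : 0 <= r by rewrite mulr_ge0// sqr_ge0.
have [c cP] := heat_taylor heatC x ds.
pose h z' := - (l * D z z').
(* The errors: [A] from the Taylor expansion in space and [E1] from that in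
   time, [B] and [E2] from freezing the arguments of [heat2] in the corrector. *)
pose A z' := heat s (x + h z') - heat s x - h z' * c - h z' ^+ 2 / 2 * heat2 s x.
pose B z' := l ^+ 2 / 2 * (heat2 s (x + h z') - heat2 s x) * w z'.
pose E1 := heat (s + r) x - heat s x - r / 2 * heat2 s x.
pose E2 := l ^+ 2 / 2 * (heat2 (s + r) x - heat2 s x) * w z.
have xh z' : y - l * (m + D z z') = x + h z' by rewrite /x /h; ring.
have -> : \sum_z' Q z z' * (heat s (y - l * (m + D z z')) +
     l ^+ 2 / 2 * heat2 s (y - l * (m + D z z')) * w z') -
   (heat (s + r) x + l ^+ 2 / 2 * heat2 (s + r) x * w z) =
   \sum_z' Q z z' * (A z' + B z') - E1 - E2.
  have -> : \sum_z' Q z z' * (heat s (y - l * (m + D z z')) +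
     l ^+ 2 / 2 * heat2 s (y - l * (m + D z z')) * w z') =
     \sum_z' Q z z' * (A z' + B z') + heat s x * (\sum_z' Q z z')
      - l * c * (\sum_z' Q z z' * D z z') + l ^+ 2 / 2 * heat2 s x * V z
      + l ^+ 2 / 2 * heat2 s x * T w z.
    rewrite /V /increment_variance /T /transition -/D !mulr_sumr -sumrN -!big_split.
    apply: eq_bigr => z' _ /=; rewrite xh /A /B.
    have -> : h z' ^+ 2 = (l * D z z') ^+ 2 by rewrite /h sqrrN.
    by rewrite /h; field.
  rewrite Q_sum1 increment_centered// /E1 /E2.
  have -> : T w z = w z - V z + S by rewrite -[X in w z - X](subrK S) -w_poisson /S; ring.
  by rewrite /r; field.
have l3 : l ^+ 4 <= l ^+ 3 by rewrite [l ^+ 4]exprS ler_piMl// exprn_ge0.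
have l30 : 0 <= l ^+ 3 by rewrite exprn_ge0.
have hle z' : `|h z'| <= l * (2 * U).
  by rewrite normrN normrM (ger0_norm l0) ler_wpM2l// increment_le.
have Ale z' : `|A z'| <= C * (2 * U) ^+ 3 * l ^+ 3.
  apply: le_trans (cP _) _; rewrite -mulrA ler_wpM2l// -exprMn [2 * U * l]mulrC.
  by apply: lerXn2r; rewrite ?nnegrE ?mulr_ge0.
have Ble z' : `|B z'| <= C * ((2 * U) * W) * l ^+ 3.
  rewrite /B norm_half_sqr.
  have b1 : `|heat2 s (x + h z') - heat2 s x| <= C * (l * (2 * U)).
    by apply: le_trans (heat2_lip heatC _ _ ds) _; rewrite ler_wpM2l.
  apply: (@le_trans _ _ (l ^+ 2 * 1 * (C * (l * (2 * U))) * W)).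
    rewrite ler_pM ?mulr_ge0 ?sqr_ge0 ?invr_ge0//. rewrite ler_pM ?mulr_ge0 ?sqr_ge0 ?invr_ge0//.
    by rewrite ler_wpM2l ?sqr_ge0//; lra.
  have -> : l ^+ 2 * 1 * (C * (l * (2 * U))) * W = C * (2 * U * W) * l ^+ 3 by ring.
  exact: lexx.
have E1le : `|E1| <= C * S ^+ 2 * l ^+ 3.
  apply: le_trans (heat_step heatC x ds r0) _; rewrite -mulrA ler_wpM2l//.
  by rewrite /r exprMn -exprM ler_wpM2l// sqr_ge0.
have E2le : `|E2| <= C * (S * W) * l ^+ 3.
  rewrite /E2 norm_half_sqr.
  have b1 := heat2_lip_t heatC x ds r0.
  apply: (@le_trans _ _ (l ^+ 2 * 1 * (C * r) * W)).
    rewrite ler_pM ?mulr_ge0 ?sqr_ge0 ?invr_ge0//. rewrite ler_pM ?mulr_ge0 ?sqr_ge0 ?invr_ge0//.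
    by rewrite ler_wpM2l ?sqr_ge0//; lra.
  have -> : l ^+ 2 * 1 * (C * r) * W = C * (S * W) * l ^+ 4 by rewrite /r; ring.
  by rewrite ler_wpM2l// !mulr_ge0.
apply: le_trans (ler_normB _ _) _.
apply: le_trans (lerD (ler_normB _ _) (lexx _)) _.
have ABle : `|\sum_z' Q z z' * (A z' + B z')| <=
    C * (2 * U) ^+ 3 * l ^+ 3 + C * ((2 * U) * W) * l ^+ 3.
  apply: le_trans (ler_norm_sum _ _ _) _.
  rewrite (eq_bigr (fun z' => Q z z' * `|A z' + B z'|)); last first.
    by move=> z' _; rewrite normrM ger0_norm.
  apply: transition_le => // z'; apply: le_trans (ler_normD _ _) _.
  exact: lerD (Ale _) (Ble _).
rewrite /K1; move: ABle E1le E2le; lra.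
Qed.

(** Summing [n] steps; [l = 1 / sqrt (n + 1)] makes the bound tend to 0. *)
Lemma lindeberg_bound n l y : 0 <= l <= 1 ->
  `|Ex (fun q : path_space L n => heat d (y - l * martingale Q u q)) -
    heat (d + S * (l ^+ 2 * n%:R)) y|
  <= (K1 + 2 * (C * W) + C * U) * (l + l ^+ 3 * n%:R).
Proof.
move=> /[dup] l01 /andP[l0 l1].
have tele k s : d <= s ->
  `|Ex (fun q : path_space L k =>
        corrected_heat l y s (martingale Q u q) (last_state q)) -
    Ex (fun q : path_space L 0 =>
        corrected_heat l y (s + S * (l ^+ 2 * k%:R)) (martingale Q u q) (last_state q))|
  <= K1 * l ^+ 3 * k%:R.
  elim: k s => [|k IH] s ds; first by rewrite !mulr0 addr0 subrr normr0.
  have r0 : 0 <= S * l ^+ 2 by rewrite mulr_ge0// sqr_ge0.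
  have := IH (s + S * l ^+ 2) _.
  have -> : s + S * l ^+ 2 + S * (l ^+ 2 * k%:R) = s + S * (l ^+ 2 * k.+1%:R).
    by rewrite -[k.+1%:R]natr1; ring.
  move=> /(_ (ler_wpDr r0 ds)) H.
  have -> : K1 * l ^+ 3 * k.+1%:R = K1 * l ^+ 3 + K1 * l ^+ 3 * k%:R.
    by rewrite -[k.+1%:R]natr1; ring.
  apply: le_trans (ler_distD _ _ _) (lerD _ H).
  rewrite [X in `|X - _|]path_mean_step; apply: path_mean_dist => // q /=.
  exact: corrected_heat_step.
have corr s x z : d <= s ->
    `|corrected_heat l y s x z - heat s (y - l * x)| <= C * W * l.
  move=> ds; rewrite /corrected_heat addrC addKr norm_half_sqr.
  have h2 := heat2_bound heatC (y - l * x) ds.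
  have l2 : l ^+ 2 / 2 <= l.
    have : l ^+ 2 <= l by rewrite expr2 ler_piMl.
    by have := sqr_ge0 l; lra.
  have l20 : 0 <= l ^+ 2 / 2 by rewrite divr_ge0// sqr_ge0.
  have -> : C * W * l = l * C * W by ring.
  by apply: ler_pM; rewrite ?mulr_ge0// ler_pM.
have t0 : 0 <= S * (l ^+ 2 * n%:R) by rewrite !mulr_ge0 ?sqr_ge0.
have dt : d <= d + S * (l ^+ 2 * n%:R) by rewrite lerDl.
have h1 := tele n d (lexx d).
have h2 : `|Ex (fun q : path_space L n => heat d (y - l * martingale Q u q)) -
  Ex (fun q : path_space L n =>
        corrected_heat l y d (martingale Q u q) (last_state q))| <= C * W * l.
  by apply: path_mean_dist => // q; rewrite distrC; exact: corr.
have h3 : `|Ex (fun q : path_space L 0 =>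
        corrected_heat l y (d + S * (l ^+ 2 * n%:R)) (martingale Q u q) (last_state q))
    - heat (d + S * (l ^+ 2 * n%:R)) y| <= C * W * l + C * U * l.
  rewrite -[X in _ - X](path_mean_cst Q_trans mu_distr 0).
  apply: path_mean_dist => // z; apply: le_trans (ler_distD _ _ _) (lerD (corr _ _ _ dt) _).
  apply: le_trans (heat_lip heatC _ _ dt) _; rewrite -mulrA ler_wpM2l//=.
  by rewrite normrN normrM (ger0_norm l0) mulrC ler_wpM2r.
apply: le_trans (ler_distD (Ex (fun q : path_space L n =>
  corrected_heat l y d (martingale Q u q) (last_state q))) _ _) _.
apply: le_trans (lerD h2 (ler_distD (Ex (fun q : path_space L 0 => corrected_heat l y
  (d + S * (l ^+ 2 * n%:R)) (martingale Q u q) (last_state q))) _ _)) _.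
apply: le_trans (lerD (lexx _) (lerD h1 h3)) _.
have K10 : 0 <= K1 by rewrite mulr_ge0// !addr_ge0 ?mulr_ge0 ?exprn_ge0 ?mulr_ge0.
have k1 : 0 <= K1 * l by rewrite mulr_ge0.
have k2 : 0 <= C * W * (l ^+ 3 * n%:R) by rewrite !mulr_ge0// exprn_ge0.
have k3 : 0 <= C * U * (l ^+ 3 * n%:R) by rewrite !mulr_ge0// exprn_ge0.
have k4 : 0 <= C * W * l by rewrite !mulr_ge0.
lra.
Qed.
End Lindeberg.

(** * The tilted law *)

Section TiltedLimit.
Variables (R : realType) (L : finType) (Q : L -> L -> R) (mu p psi : L -> R).
Hypothesis Q_trans : is_transition_function Q.
Hypothesis Q_irr : irreducible_transition Q.
Hypothesis Q_aper : aperiodic_transition Q.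
Hypothesis p_stat : is_stationary p Q.
Hypothesis mu_distr : is_distribution mu.
Hypothesis psi_gt0 : forall z, 0 < psi z.

Let Ex n := @path_mean R L Q mu n.

(** Expectation under [Q_n] of a function of the path, [psi] being [1 / phi]. *)
Definition tilted_mean n (F : path_space L n -> R) : R :=
  path_mean Q mu (fun q => psi (last_state q) * F q) /
  path_mean Q mu (fun q : path_space L n => psi (last_state q)).

Lemma tilt_lbound : exists2 c, 0 < c & forall n,
  c <= Ex (fun q : path_space L n => psi (last_state q)).
Proof.
have [c c0 cP] := finite_positive_lbound psi_gt0.
exists c => // n; rewrite -[leLHS](path_mean_cst Q_trans mu_distr n).
exact: path_mean_le.
Qed.

Lemma tilt_mass_gt0 n : 0 < Ex (fun q : path_space L n => psi (last_state q)).
Proof. by have [c c0 /(_ n)] := tilt_lbound; apply: lt_le_trans. Qed.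

Lemma tilted_mean_le n (F G : path_space L n -> R) :
  (forall q, F q <= G q) -> tilted_mean F <= tilted_mean G.
Proof.
move=> FG; rewrite ler_wpM2r ?invr_ge0 ?(ltW (tilt_mass_gt0 n))//.
by apply: path_mean_le => // q; rewrite ler_wpM2l ?FG // ltW.
Qed.

Lemma tilted_mean_cst n c : tilted_mean (fun _ : path_space L n => c) = c.
Proof.
rewrite /tilted_mean; under path_mean_ext do rewrite mulrC.
by rewrite path_meanZ mulfK// lt0r_neq0// tilt_mass_gt0.
Qed.

Lemma tilted_meanD n (F G : path_space L n -> R) :
  tilted_mean (fun q => F q + G q) = tilted_mean F + tilted_mean G.
Proof.
rewrite /tilted_mean -mulrDl -path_meanD; congr (_ / _).
by apply: path_mean_ext => q; rewrite mulrDr.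
Qed.

(** The density of the tilted law is bounded by [max psi / min psi]. *)
Lemma tilted_mean_le_mean : exists2 B, 0 <= B & forall n (F : path_space L n -> R),
  (forall q, 0 <= F q) -> tilted_mean F <= B * path_mean Q mu F.
Proof.
have [A A0 psiA] := finite_bounded psi; have [c c0 cP] := tilt_lbound.
exists (A / c); first by rewrite divr_ge0// ltW.
move=> n F F0; rewrite /tilted_mean ler_pdivrMr ?tilt_mass_gt0//.
have m0 : 0 <= path_mean Q mu F.
  rewrite -(path_mean_cst Q_trans mu_distr n 0); exact: path_mean_le.
apply: (@le_trans _ _ (A * path_mean Q mu F)).
  rewrite -path_meanZ; apply: path_mean_le => // q.
  by rewrite ler_wpM2r// (le_trans (ler_norm _)).
rewrite [leRHS](_ : _ = A * path_mean Q mu F *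
  (Ex (fun q : path_space L n => psi (last_state q)) / c)); last by rewrite /Ex; ring.
by rewrite ler_peMr ?mulr_ge0// ler_pdivlMr// mul1r cP.
Qed.

Lemma cvg_inv_sqrt : (Num.sqrt (n.+1%:R : R))^-1 @[n --> \oo] --> (0 : R).
Proof.
have h := @cvg_harmonic R.
have := cvg_comp _ _ h (@sqrt_continuous R 0).
rewrite sqrtr0; apply: cvg_trans; apply: near_eq_cvg; near=> n.
by rewrite /= sqrtrV.
Unshelve. all: by end_near. Qed.

Variables (f u : L -> R).
Hypothesis u_poisson : forall z, u z - transition Q u z = f z.

Let S := rmean p (increment_variance Q u).
Let T := transition Q.

(** For a fixed large [K], the last [K] steps equilibrate the weight [psi] but are
   too few to change the rescaled sum. *)
Lemma tilted_heat_limit (d y : R) : 0 < d ->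
  tilted_mean (fun q : path_space L n =>
    heat d (y - path_sum f q / Num.sqrt n.+1%:R)) @[n --> \oo]
  --> heat (d + S) y.
Proof.
move=> d0.
have [C heatC] := heat_regularity d0.
have C0 := heat_regular_ge0 heatC.
have S0 : 0 <= S by apply: mean_variance_ge0.
have [w _ wP] : exists2 w, rmean p w = 0 &
    forall z, w z - transition Q w z = increment_variance Q u z - S.
  apply: poisson_exists => //.
  by rewrite (rmeanB p (increment_variance Q u)) (rmean_cst p_stat) subrr.
have [U U0 uU] := finite_bounded u; have [W W0 wW] := finite_bounded w.
have [A A0 psiA] := finite_bounded psi.
have [c c0 cP] := tilt_lbound.
set K1 := C * ((2 * U) ^+ 3 + 2 * U * W + S ^+ 2 + S * W) + 2 * (C * W) + C * U.
have K10 : 0 <= K1.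
  have q : 0 <= (2 * U) ^+ 3 + 2 * U * W + S ^+ 2 + S * W.
    by do !apply: addr_ge0; rewrite ?exprn_ge0 ?mulr_ge0.
  by rewrite /K1; do !apply: addr_ge0; do ?apply: mulr_ge0; rewrite ?mulr_ge0.
have lind m l : 0 <= l <= 1 ->
  `|Ex (fun q : path_space L m => heat d (y - l * martingale Q u q)) -
    heat (d + S * (l ^+ 2 * m%:R)) y| <= K1 * (l + l ^+ 3 * m%:R).
  move=> l01; exact: (lindeberg_bound Q_trans p_stat mu_distr wP U0 W0 uU wW heatC).
have hb (x s : R) : 0 <= heat s x <= 1 by rewrite normal_cdf_ge0 normal_cdf_le1.
have pim : 0 <= rmean p psi.
  apply: sumr_ge0 => z _; rewrite mulr_ge0 //; [by case: p_stat => -[]|exact: ltW].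
(* What multiplies [1 / sqrt (n + 1)] once [K] is fixed. *)
pose err K := A * (C * U) + K%:R * (A * (C * (2 * U))) +
    rmean p psi * (K1 * 2) + rmean p psi * (C * (S * K.+1%:R)).
have main e : 0 < e -> exists K, forall m, let n := (K + m)%N in
    let l := (Num.sqrt n.+1%:R)^-1 in
    `|Ex (fun q : path_space L n => psi (last_state q) *
        heat d (y - path_sum f q / Num.sqrt n.+1%:R)) -
      Ex (fun q : path_space L n => psi (last_state q)) * heat (d + S) y|
    <= 2 * e + err K * l.
  move=> e0; have [K KP] := ergodic_convergence Q_trans Q_irr Q_aper p_stat psi e0.
  exists K; move=> m; cbv zeta; set n := (K + m)%N; set l := (Num.sqrt n.+1%:R)^-1.
  have n0 : 0 < n.+1%:R :> R by rewrite ltr0n.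
  have l0 : 0 < l by rewrite invr_gt0 sqrtr_gt0.
  have l2 : l ^+ 2 = n.+1%:R^-1 by rewrite exprVn sqr_sqrtr// ltW.
  have l1 : l <= 1.
    rewrite -(@ler_pXn2r _ 2)// ?nnegrE ?(ltW l0)// l2 expr1n invf_le1//.
    by rewrite ler1n.
  have nE : n.+1%:R = K.+1%:R + m%:R :> R by rewrite -natrD addSn.
  have l2n : l ^+ 2 * (K.+1%:R + m%:R) = 1.
    by rewrite l2 -nE mulVf// lt0r_neq0.
  have m0 : 0 <= m%:R :> R by [].
  have l2m : l ^+ 2 * m%:R <= 1.
    by rewrite -[leRHS]l2n ler_wpM2l ?sqr_ge0// lerDr.
  pose g x := heat d (y - l * x).
  have gl x h : `|g (x + h) - g x| <= C * l * `|h|.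
    rewrite /g mulrDr opprD addrA; apply: le_trans (heat_lip heatC _ _ (lexx d)) _.
    by rewrite normrN normrM (gtr0_norm l0) mulrA.
  (* From [X1] to [X7]: replace the sum by the martingale, drop the last [K]
     steps, replace the averaged weight by its limit, apply Lindeberg's bound,
     complete the time to [d + S], restore the tilting mass. *)
  pose X1 := Ex (fun q : path_space L n => psi (last_state q) *
        heat d (y - path_sum f q / Num.sqrt n.+1%:R)).
  pose X2 := Ex (fun q : path_space L n => psi (last_state q) * g (martingale Q u q)).
  pose X3 := Ex (fun q : path_space L m =>
        iter K T psi (last_state q) * g (martingale Q u q)).
  pose X4 := rmean p psi * Ex (fun q : path_space L m => g (martingale Q u q)).
  pose X5 := rmean p psi * heat (d + S * (l ^+ 2 * m%:R)) y.
  pose X6 := rmean p psi * heat (d + S) y.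
  pose X7 := Ex (fun q : path_space L n => psi (last_state q)) * heat (d + S) y.
  have e12 : `|X1 - X2| <= A * (C * U) * l.
    apply: path_mean_dist => // q; rewrite -mulrBr normrM.
    have -> : A * (C * U) * l = A * (C * l * U) by ring.
    rewrite ler_pM// (path_sum_martingale u_poisson) [_ / Num.sqrt _]mulrC.
    apply: le_trans (gl _ _) _; rewrite normrN ler_wpM2l ?mulr_ge0 ?(ltW l0)//.
    exact: transition_norm_le.
  have e23 : `|X2 - X3| <= K%:R * (A * (C * (2 * U))) * l.
    have := forget_final_weight Q_trans mu_distr uU m K psiA gl.
    by move=> H; apply: le_trans H _; rewrite le_eqVlt; apply/orP; left; apply/eqP; ring.
  have e34 : `|X3 - X4| <= e.
    rewrite /X4 /Ex -path_meanZ; apply: path_mean_dist => // q.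
    rewrite -mulrBl normrM -[leRHS]mulr1; have /andP[g0 g1] := hb (y - l * martingale Q u q) d.
    by rewrite ler_pM// ?KP// ger0_norm.
  have e45 : `|X4 - X5| <= rmean p psi * (K1 * 2) * l.
    rewrite /X4 /X5 -mulrBr normrM (ger0_norm pim) -mulrA ler_wpM2l//.
    apply: le_trans (lind _ _ _) _; first by rewrite (ltW l0).
    rewrite -mulrA ler_wpM2l//.
    have -> : l ^+ 3 * m%:R = l * (l ^+ 2 * m%:R) by ring.
    by have := ler_wpM2l (ltW l0) l2m; lra.
  have e56 : `|X5 - X6| <= rmean p psi * (C * (S * K.+1%:R)) * l.
    rewrite /X5 /X6 -mulrBr normrM (ger0_norm pim) -mulrA ler_wpM2l//.
    have ds : d <= d + S * (l ^+ 2 * m%:R) by rewrite lerDl mulr_ge0// mulr_ge0// sqr_ge0.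
    have r0 : 0 <= S * (l ^+ 2 * K.+1%:R) by rewrite mulr_ge0// mulr_ge0// sqr_ge0.
    have := heat_lip_t heatC y ds r0.
    have -> : d + S * (l ^+ 2 * m%:R) + S * (l ^+ 2 * K.+1%:R) = d + S.
      by rewrite -addrA -mulrDr -mulrDr [m%:R + _]addrC l2n mulr1.
    rewrite distrC => H; apply: le_trans H _; rewrite -mulrA ler_wpM2l//.
    by rewrite -mulrA ler_wpM2l// mulrC ler_wpM2l// expr2 ler_piMl// ltW.
  have e67 : `|X6 - X7| <= e.
    have /andP[g0 g1] := hb y (d + S).
    rewrite /X6 /X7 -mulrBl normrM -[leRHS]mulr1 ler_pM// ?(ger0_norm g0)//.
    have cl0 (x h : R) : `|(fun=> 1 : R) (x + h) - (fun=> 1) x| <= (0 : R) * `|h|.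
      by rewrite subrr normr0 mul0r.
    have := forget_final_weight Q_trans mu_distr uU m K psiA cl0.
    rewrite !mul0r !mulr0 normr_le0 subr_eq0 => /eqP H.
    have -> : Ex (fun q : path_space L n => psi (last_state q)) =
        Ex (fun q : path_space L m => iter K T psi (last_state q)).
      transitivity (Ex (fun q : path_space L n => psi (last_state q) * 1)).
        by apply: path_mean_ext => q; rewrite mulr1.
      by rewrite /Ex H; apply: path_mean_ext => q; rewrite mulr1.
    rewrite -[X in X - _](path_mean_cst Q_trans mu_distr m); apply: path_mean_dist => // q.
    by rewrite distrC KP.
  change (`|X1 - X7| <= 2 * e + err K * l).
  have -> : X1 - X7 = (X1 - X2) + (X2 - X3) + (X3 - X4) + (X4 - X5) + (X5 - X6) + (X6 - X7).
    by ring.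
  move: e12 e23 e34 e45 e56 e67.
  move: (X1 - X2) (X2 - X3) (X3 - X4) (X4 - X5) (X5 - X6) (X6 - X7) => x1 x2 x3 x4 x5 x6.
  rewrite !ler_norml /err => /andP[? ?] /andP[? ?] /andP[? ?] /andP[? ?] /andP[? ?] /andP[? ?].
  by apply/andP; split; lra.
apply/cvgrPdist_le => e e0.
have ce : 0 < c * e / 4 by rewrite divr_gt0 ?mulr_gt0.
have [K KP] := main _ ce.
have err0 : 0 <= err K.
  have q : 0 <= C * S by rewrite mulr_ge0.
  by rewrite /err; do !apply: addr_ge0; do !apply: mulr_ge0.
have /cvgrPdist_le/(_ (c * e / 2 / (err K + 1))) := cvg_inv_sqrt.
case=> [|N _ NP]; first by rewrite !divr_gt0 ?mulr_gt0 ?ltr_wpDl.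
exists (maxn K N) => // n /=; rewrite geq_max => /andP[Kn Nn].
have := KP (n - K)%N; rewrite subnKC//= => H.
have := NP n Nn; rewrite /= sub0r normrN ger0_norm ?invr_ge0 ?sqrtr_ge0// => ln.
have el : err K * (Num.sqrt n.+1%:R)^-1 <= c * e / 2.
  apply: le_trans (ler_wpM2l err0 ln) _.
  rewrite mulrA ler_pdivrMr ?ltr_wpDl// mulrC ler_wpM2l ?lerDl//.
  by rewrite ltW// divr_gt0 ?mulr_gt0.
have m0 := tilt_mass_gt0 n.
rewrite distrC -(ler_pM2r m0) -[X in _ * X](gtr0_norm m0) -normrM mulrBl.
rewrite /tilted_mean divfK ?lt0r_neq0// mulrC.
apply: le_trans (le_trans H _) (ler_wpM2l (ltW e0) (cP n)).
by move: el; lra.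
Qed.

End TiltedLimit.

(** * From smoothed to plain distribution functions *)

Section Sandwich.
Variable R : realType.
Implicit Types a e x S W : R.

Lemma normal_tails e : 0 < e -> exists2 M, 0 < M & forall z, M <= z ->
  1 - normal_cdf 1 z <= e /\ normal_cdf 1 (- z) <= e.
Proof.
move=> e0.
have /cvgrPdist_le/(_ e e0)[M1 [_ M1P]] := @normal_cdf_cvgy R 1.
have /cvgrPdist_le/(_ e e0)[M2 [_ M2P]] := @normal_cdf_cvgNy R 1.
exists (1 + `|M1| + `|M2|); first by have := normr_ge0 M1; have := normr_ge0 M2; lra.
move=> z zM; split.
  apply: le_trans (ler_norm _) _; apply: M1P.
  by have := ler_norm M1; have := normr_ge0 M2; lra.
have : `|0 - normal_cdf 1 (- z)| <= e.
  apply: M2P; have := ler_norm (- M2); rewrite normrN; have := normr_ge0 M1; lra.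
by rewrite sub0r normrN ger0_norm ?normal_cdf_ge0.
Qed.

Lemma heat_pow4 a x : 0 < a -> heat (a ^+ 4) x = normal_cdf 1 (x / a ^+ 2).
Proof.
move=> a0; rewrite /heat; congr (normal_cdf 1 (x / _)).
have -> : a ^+ 4 = (a ^+ 2) ^+ 2 by ring.
by rewrite sqrtr_sqr ger0_norm// sqr_ge0.
Qed.

(** Smoothing with variance [a ^+ 4] has standard deviation [a ^+ 2], so a shift by
   [a] is worth [a^-1] standard deviations. *)
Lemma heat_sandwich a x W : 0 < a ->
  heat (a ^+ 4) (x - a - W) - normal_cdf 1 (- a^-1) <= (W <= x)%R%:R
    <= heat (a ^+ 4) (x + a - W) + (1 - normal_cdf 1 a^-1).
Proof.
move=> a0; rewrite !heat_pow4//.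
have aE : a / a ^+ 2 = a^-1 by rewrite expr2 invfM mulrA divff ?mul1r// lt0r_neq0.
have aP : 0 < a ^- 2 by rewrite invr_gt0 exprn_gt0.
have [Wx|xW] := leP W x.
  apply/andP; split.
    have := normal_cdf_le1 1 ((x - a - W) / a ^+ 2); have := normal_cdf_ge0 1 (- a^-1).
    by rewrite mulr1n; lra.
  have : normal_cdf 1 a^-1 <= normal_cdf 1 ((x + a - W) / a ^+ 2).
    by apply: normal_cdf_mono; rewrite -aE ler_pM2r//; lra.
  by rewrite mulr1n; lra.
apply/andP; split.
  have : normal_cdf 1 ((x - a - W) / a ^+ 2) <= normal_cdf 1 (- a^-1).
    by apply: normal_cdf_mono; rewrite -aE -mulNr ler_pM2r//; lra.
  by rewrite mulr0n; lra.
have := normal_cdf_le1 1 a^-1; have := normal_cdf_ge0 1 ((x + a - W) / a ^+ 2).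
by rewrite mulr0n; lra.
Qed.

Lemma centered_normal_cdf_gt0 S x : 0 < S -> centered_normal_cdf S x = heat S x.
Proof.
move=> S0; rewrite /centered_normal_cdf /centered_normal gt_eqF//.
by rewrite -/(normal_cdf (Num.sqrt S) x) normal_cdf_scale ?sqrtr_gt0.
Qed.

Lemma centered_normal_cdf0 x : centered_normal_cdf 0 x = (0 <= x)%R%:R.
Proof.
rewrite /centered_normal_cdf /centered_normal eqxx diracE/=.
by rewrite mem_setE in_itv.
Qed.

(** For [S > 0] by regularity of [heat] near [S]. For [S = 0] the limit is a unit
   step at 0; continuity excludes [x = 0], and for other [x] the shifted point stays
   at least [a^-1] standard deviations away from the step. *)
Lemma heat_cdf_limit S x e : 0 <= S -> 0 < e ->
  {for x, continuous (centered_normal_cdf S)} ->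
  exists a, [/\ 0 < a, 1 - normal_cdf 1 a^-1 <= e, normal_cdf 1 (- a^-1) <= e,
    heat (a ^+ 4 + S) (x + a) <= centered_normal_cdf S x + e &
    centered_normal_cdf S x - e <= heat (a ^+ 4 + S) (x - a)].
Proof.
move=> S0 e0 Gc; have [M M0 MP] := normal_tails e0.
have small k : 0 < k -> exists a, [/\ 0 < a, a <= 1, a <= k & M <= a^-1].
  move=> k0; exists (Num.min 1 (Num.min k M^-1)).
  have m0 : 0 < Num.min 1 (Num.min k M^-1) by rewrite !lt_min ltr01 k0 invr_gt0 M0.
  split=> //; rewrite ?ge_min ?lexx ?orbT//.
  by rewrite invf_pge ?posrE// !ge_min lexx !orbT.
move: S0; rewrite le_eqVlt => /orP[/eqP S0|S0].
  rewrite -{}S0 in Gc *; rewrite centered_normal_cdf0.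
  have x0 : x != 0.
    apply/eqP => x0; rewrite {}x0 in Gc.
    have h0 : 0 < 2^-1 :> R by rewrite invr_gt0.
    have /cvgrPdist_le/(_ _ h0)[r/= r0 rP] := Gc.
    have := rP (- (r / 2)).
    rewrite /ball_/= opprK add0r gtr0_norm ?divr_gt0// !centered_normal_cdf0.
    have -> : (0 <= - (r / 2)) = false.
      by apply/negbTE; rewrite oppr_ge0 -ltNge divr_gt0.
    rewrite lexx subr0 normr1 => H.
    by have : 1 <= 2^-1 :> R by [apply: H; lra]; lra.
  have x2 : 0 < `|x| / 2 by rewrite divr_gt0// normr_gt0.
  have [a [a0 a1 ax /MP[t1 t2]]] := small _ x2.
  exists a; split=> //; rewrite addr0 heat_pow4//.
  - have [x_ge0|x_lt0] := leP 0 x.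
      by have := normal_cdf_le1 1 ((x + a) / a ^+ 2); rewrite mulr1n; lra.
    rewrite mulr0n add0r; apply: le_trans t2; apply: normal_cdf_mono.
    rewrite ler_pdivrMr ?exprn_gt0// mulNr expr2 mulrA mulVf ?lt0r_neq0// mul1r.
    by move: ax; rewrite ltr0_norm//; lra.
  - have [x_ge0|x_lt0] := leP 0 x.
      rewrite mulr1n lerBlDl -lerBlDr; apply: le_trans t1; rewrite lerD2l lerN2.
      apply: normal_cdf_mono.
      rewrite ler_pdivlMr ?exprn_gt0// expr2 mulrA mulVf ?lt0r_neq0// mul1r.
      by move: ax; rewrite ger0_norm//; lra.
    by have := normal_cdf_ge0 1 ((x - a) / a ^+ 2); rewrite mulr0n; lra.
have [C hC] := heat_regularity S0; have C0 := heat_regular_ge0 hC.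
have k0 : 0 < e / (2 * C + 1) by rewrite divr_gt0//; lra.
have [a [a0 a1 ak /MP[t1 t2]]] := small _ k0.
have bnd (h : R) : `|h| = a -> `|heat (a ^+ 4 + S) (x + h) - heat S x| <= e.
  move=> ha; have a40 : 0 <= a ^+ 4 by rewrite exprn_ge0// ltW.
  have h1 := heat_lip_t hC (x + h) (lexx S) a40.
  have h2 := heat_lip hC x h (lexx S); rewrite ha in h2.
  rewrite [a ^+ 4 + S]addrC; apply: le_trans (ler_distD (heat S (x + h)) _ _) _.
  have a4 : a ^+ 4 <= a by rewrite exprS ler_piMr ?(ltW a0)// exprn_ile1// ltW.
  have : C * a ^+ 4 <= C * a by rewrite ler_wpM2l.
  have : a * (2 * C + 1) <= e by move: ak; rewrite ler_pdivlMr//; lra.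
  by move: h1 h2; lra.
exists a; split=> //; rewrite centered_normal_cdf_gt0//.
  by have := bnd a (gtr0_norm a0); rewrite ler_norml => /andP[_]; lra.
have := bnd (- a); rewrite normrN => /(_ (gtr0_norm a0)).
by rewrite ler_norml => /andP[]; lra.
Qed.

End Sandwich.


(** * Limit theorems on path space *)

Section PathLimitTheorems.
Variables (R : realType) (L : finType) (Q : L -> L -> R) (mu p psi : L -> R).
Hypothesis Q_trans : is_transition_function Q.
Hypothesis Q_irr : irreducible_transition Q.
Hypothesis Q_aper : aperiodic_transition Q.
Hypothesis p_stat : is_stationary p Q.
Hypothesis mu_distr : is_distribution mu.
Hypothesis psi_gt0 : forall z, 0 < psi z.
Variables (f u : L -> R).
Hypothesis u_poisson : forall z, u z - transition Q u z = f z.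

Lemma path_clt :
  cvg_in_distribution
    (fun n x => tilted_mean Q mu psi (fun q : path_space L n =>
       (path_sum f q / Num.sqrt n.+1%:R <= x)%R%:R))
    (centered_normal_cdf (rmean p (increment_variance Q u))).
Proof.
set S := rmean p (increment_variance Q u).
move=> x Gc; apply/cvgrPdist_le => e e0.
have e3 : 0 < e / 3 by rewrite divr_gt0.
have S0 : 0 <= S by exact: mean_variance_ge0.
have [a [a0 t1 t2 up lo]] := heat_cdf_limit S0 e3 Gc.
have lim (y : R) := tilted_heat_limit Q_trans Q_irr Q_aper p_stat mu_distr psi_gt0
  u_poisson (y := y) (exprn_gt0 4 a0).
have /cvgrPdist_le/(_ _ e3) := lim (x + a).
have /cvgrPdist_le/(_ _ e3) := lim (x - a).
apply: filterS2 => n; rewrite -/S => l2 l1.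
pose h y (q : path_space L n) := heat (a ^+ 4) (y - path_sum f q / Num.sqrt n.+1%:R).
have u1 : tilted_mean Q mu psi (fun q : path_space L n =>
       (path_sum f q / Num.sqrt n.+1%:R <= x)%R%:R) <=
    tilted_mean Q mu psi (h (x + a)) + e / 3.
  rewrite -[e / 3](tilted_mean_cst Q_trans mu_distr psi_gt0 n) -tilted_meanD.
  apply: tilted_mean_le => // q.
  have /andP[_ H] := heat_sandwich x (path_sum f q / Num.sqrt n.+1%:R) a0.
  by apply: le_trans H _; rewrite lerD2l.
have u2 : tilted_mean Q mu psi (h (x - a)) <=
   tilted_mean Q mu psi (fun q : path_space L n =>
       (path_sum f q / Num.sqrt n.+1%:R <= x)%R%:R) + e / 3.
  rewrite -[e / 3](tilted_mean_cst Q_trans mu_distr psi_gt0 n) -tilted_meanD.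
  apply: tilted_mean_le => // q.
  have /andP[H _] := heat_sandwich x (path_sum f q / Num.sqrt n.+1%:R) a0.
  by rewrite lerBlDr in H; apply: le_trans H _; rewrite lerD2l.
move: l1 l2 u1 u2; rewrite -/(h _) /h !ler_norml => /andP[? ?] /andP[? ?] ? ?.
by apply/andP; split; lra.
Qed.

Lemma path_sum_second_moment : exists2 B, 0 <= B & forall n,
  path_mean Q mu (fun q : path_space L n => path_sum f q ^+ 2) <= B * n.+1%:R.
Proof.
have [U U0 uU] := finite_bounded u.
exists (2 * (2 * U) ^+ 2 + 2 * U ^+ 2).
  by rewrite addr_ge0// mulr_ge0// sqr_ge0.
move=> n.
have := martingale_second_moment Q_trans mu_distr U0 uU n => H.
apply: (@le_trans _ _ (2 * ((2 * U) ^+ 2 * n.+1%:R) + 2 * U ^+ 2)); last first.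
  have : U ^+ 2 <= U ^+ 2 * n.+1%:R by rewrite ler_peMr ?sqr_ge0// ler1n.
  lra.
apply: le_trans (lerD (ler_wpM2l _ H) (lexx _)) => //.
rewrite -path_meanZ -[X in _ + X](path_mean_cst Q_trans mu_distr n) -path_meanD.
apply: path_mean_le => // q; rewrite (path_sum_martingale u_poisson).
have := transition_norm_le Q_trans uU (last_state q).
move: (martingale _ _ _) (transition _ _ _) => m t; rewrite ler_norml => /andP[t1 t2].
have : 0 <= (m + t) ^+ 2 by exact: sqr_ge0.
have : t ^+ 2 <= U ^+ 2 by nra.
nra.
Qed.

End PathLimitTheorems.

(** * From the chain to path space *)

Section Trajectory.
Variables (L : finType) (A : Type) (Z : nat -> A -> L).

Fixpoint trajectory (n : nat) (w : A) : path_space L n :=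
  match n with
  | 0%N => Z 0%N w
  | m.+1 => (trajectory m w, Z m.+1 w)
  end.

Lemma last_trajectory n w : last_state (trajectory n w) = Z n w.
Proof. by case: n. Qed.

End Trajectory.

(** The trajectory of the coordinate process: it turns the sequences [nat -> L] of
   the Markov property into elements of [path_space]. *)
Definition prefix (L : finType) := trajectory (fun i (z : nat -> L) => z i).

Lemma trajectory_prefixP (L : finType) (A : Type) (Z : nat -> A -> L) n w z :
  trajectory Z n w = prefix n z <-> forall i, (i <= n)%N -> Z i w = z i.
Proof.
elim: n => [|n [IH1 IH2]] /=.
  by split=> [e i|]; [rewrite leqn0 => /eqP ->|apply].
split=> [[/IH1 e Zn] i|e].
  by rewrite leq_eqVlt ltnS => /orP[/eqP ->|]; [|exact: e].
by rewrite e// IH2// => i /leqW; exact: e.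
Qed.

Lemma prefix_surj (L : finType) n (q : path_space L n) : exists z, prefix n z = q.
Proof.
elim: n q => [|n IH] q; first by exists (fun=> q).
case: q => q x; have [z <-] := IH q.
exists (fun i => if (i <= n)%N then z i else x); rewrite /prefix /= ltnn.
by congr (_, _); apply/trajectory_prefixP => i ->.
Qed.

Section TrajectoryLaw.
Variables (R : realType) (L : finType) (Q : L -> L -> R) (mu : L -> R).
Variables (d : measure_display) (T : measurableType d) (P : probability T R).
Variable Z : nat -> T -> L.
Hypothesis Z_chain : is_markov_chain P Z mu Q.

Lemma path_sum_trajectory (h : L -> R[i]) n w :
  path_sum h (trajectory Z n w) = additive_functional Z h n w.
Proof.
rewrite /additive_functional; elim: n => [|n IH] /=; first by rewrite big_nat1.
by rewrite big_nat_recr//= -IH.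
Qed.

Lemma measurable_trajectory n (q : path_space L n) :
  measurable [set w | trajectory Z n w = q].
Proof.
case: Z_chain => mZ _ _; elim: n q => [|n IH] q; first exact: mZ.
case: q => q x; rewrite [X in measurable X](_ : _ =
  [set w | trajectory Z n w = q] `&` (Z n.+1 @^-1` [set x])).
  exact: measurableI.
by apply/seteqP; split=> w /= => [[-> ->]|[-> ->]].
Qed.

Lemma trajectory_law n (q : path_space L n) :
  P [set w | trajectory Z n w = q] = (path_weight Q mu q)%:E.
Proof.
case: Z_chain => _ P0 PS; have [z <-] := prefix_surj q.
have E k : [set w | trajectory Z k w = prefix k z] =
    [set w | forall i, (i <= k)%N -> Z i w = z i].
  by apply/seteqP; split=> w /trajectory_prefixP.
elim: n {q} => [|n IH]; first exact: P0.
by rewrite E PS -E IH -EFinM /= last_trajectory.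
Qed.

Lemma expectation_trajectory n (F : path_space L n -> R) : (forall q, 0 <= F q) ->
  ('E_P[fun w => F (trajectory Z n w)] = (path_mean Q mu F)%:E)%E.
Proof.
move=> F0; rewrite unlock.
pose A (q : path_space L n) := [set w | trajectory Z n w = q].
have mA q : measurable (A q) by exact: measurable_trajectory.
transitivity (\int[P]_w (\sum_q (F q)%:E * (\1_(A q) w)%:E))%E.
  apply: eq_integral => w _; rewrite (bigD1 (trajectory Z n w))//= big1 ?adde0.
    by rewrite indicE mem_set// mule1.
  move=> q qw; rewrite indicE memNset ?mule0// /A/= => e.
  by rewrite e eqxx in qw.
rewrite ge0_integral_sum//; last 2 first.
- move=> q; apply: measurable_funeM; apply/measurable_EFinP.
  exact: measurable_indic.
- by move=> q w _; rewrite mule_ge0// lee_fin.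
rewrite /path_mean -sumEFin; apply: eq_bigr => q _.
rewrite ge0_integralZl_EFin//; last first.
  by apply/measurable_EFinP; exact: measurable_indic.
rewrite integral_indic// setIT EFinM [RHS]muleC; congr (_ * _)%E.
exact: trajectory_law.
Qed.

Lemma tilted_prob_trajectory (phi : L -> R) n (B : pred (path_space L n)) :
  (forall z, 0 < phi z) ->
  tilted_prob P Z phi n [set w | B (trajectory Z n w)] =
  tilted_mean Q mu (fun z => (phi z)^-1) (fun q => (B q)%:R).
Proof.
move=> phi0; rewrite /tilted_prob.
pose psi q : R := (phi (last_state (q : path_space L n)))^-1.
have psi0 q : 0 <= psi q by rewrite invr_ge0 ltW.
have psi1 q : 0 <= psi q * (B q)%:R by rewrite mulr_ge0.
rewrite (_ : (fun w => \1_[set w | B (trajectory Z n w)] w / phi (Z n w)) =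
  (fun w => psi (trajectory Z n w) * (B (trajectory Z n w))%:R)); last first.
  apply/funext => w; rewrite /psi last_trajectory mulrC; congr (_ * _).
  rewrite indicE; congr (nat_of_bool _)%:R.
  by apply/idP/idP => [/set_mem|] //= Bw; exact/mem_set.
rewrite (_ : (fun w => (phi (Z n w))^-1) = (fun w => psi (trajectory Z n w))); last first.
  by apply/funext => w; rewrite /psi last_trajectory.
by rewrite (expectation_trajectory psi1) (expectation_trajectory psi0).
Qed.

End TrajectoryLaw.

(** * Complex observables and the variance *)

Section ComplexFunctions.
Variables (R : realType) (L : finType) (Q : L -> L -> R) (p : L -> R).
Implicit Types (h k : L -> R[i]).

Definition re_part h z : R := complex.Re (h z).
Definition im_part h z : R := complex.Im (h z).

Lemma Re_scale (a : R) (x : R[i]) : complex.Re (a%:C * x) = a * complex.Re x.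
Proof. by case: x => x y /=; rewrite mul0r subr0. Qed.

Lemma Im_scale (a : R) (x : R[i]) : complex.Im (a%:C * x) = a * complex.Im x.
Proof. by case: x => x y /=; rewrite mul0r addr0. Qed.

Lemma eq_complexP (x y : R[i]) :
  complex.Re x = complex.Re y -> complex.Im x = complex.Im y -> x = y.
Proof. by case: x y => [a b] [c e] /= -> ->. Qed.

Lemma ReB (x y : R[i]) : complex.Re (x - y) = complex.Re x - complex.Re y.
Proof. by case: x y => [a b] []. Qed.

Lemma ImB (x y : R[i]) : complex.Im (x - y) = complex.Im x - complex.Im y.
Proof. by case: x y => [a b] []. Qed.

Lemma Re_weighted_sum (a : L -> R) h :
  complex.Re (\sum_z (a z)%:C * h z) = \sum_z a z * re_part h z.
Proof.
by elim/big_ind2: _ => // [x1 x2 y1 y2 <- <-|z _]; [exact: raddfD|exact: Re_scale].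
Qed.

Lemma Im_weighted_sum (a : L -> R) h :
  complex.Im (\sum_z (a z)%:C * h z) = \sum_z a z * im_part h z.
Proof.
by elim/big_ind2: _ => // [x1 x2 y1 y2 <- <-|z _]; [exact: raddfD|exact: Im_scale].
Qed.

Lemma re_mean h : complex.Re (mean p h) = rmean p (re_part h).
Proof. exact: Re_weighted_sum. Qed.

Lemma im_mean h : complex.Im (mean p h) = rmean p (im_part h).
Proof. exact: Im_weighted_sum. Qed.

Lemma re_transition h : re_part (apply_transition Q h) =1 transition Q (re_part h).
Proof. by move=> z; exact: Re_weighted_sum. Qed.

Lemma im_transition h : im_part (apply_transition Q h) =1 transition Q (im_part h).
Proof. by move=> z; exact: Im_weighted_sum. Qed.

Lemma mean_linear (a : R[i]) h k :
  mean p (fun z => a * h z + k z) = a * mean p h + mean p k.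
Proof.
rewrite /mean mulr_sumr -big_split; apply: eq_bigr => z _ /=.
by rewrite mulrDr mulrCA.
Qed.

Lemma apply_transition_linear (a : R[i]) h k z :
  apply_transition Q (fun z => a * h z + k z) z =
  a * apply_transition Q h z + apply_transition Q k z.
Proof.
rewrite /apply_transition mulr_sumr -big_split; apply: eq_bigr => y _ /=.
by rewrite mulrDr mulrCA.
Qed.

Hypothesis Q_trans : is_transition_function Q.
Hypothesis Q_irr : irreducible_transition Q.
Hypothesis Q_aper : aperiodic_transition Q.
Hypothesis p_stat : is_stationary p Q.

Lemma mean_one : mean p (fun=> 1) = 1.
Proof.
apply: eq_complexP; rewrite ?re_mean ?im_mean.
  exact: (rmean_cst p_stat 1).
exact: (rmean_cst p_stat 0).
Qed.

Lemma mean_apply_transition h : mean p (apply_transition Q h) = mean p h.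
Proof.
apply: eq_complexP; rewrite ?re_mean ?im_mean.
  rewrite -[RHS](rmean_transition p_stat); apply: eq_bigr => z _.
  by rewrite re_transition.
rewrite -[RHS](rmean_transition p_stat); apply: eq_bigr => z _.
by rewrite im_transition.
Qed.

Lemma mean_centered h : mean p (centered p h) = 0.
Proof.
have -> : centered p h = (fun z => - mean p h * (fun=> 1) z + h z).
  by apply/funext => z; rewrite /centered mulr1 addrC.
by rewrite mean_linear mean_one mulr1 addNr.
Qed.

Lemma complex_poisson_unique h k : mean p h = 0 -> mean p k = 0 ->
  (forall z, h z - apply_transition Q h z = k z - apply_transition Q k z) ->
  h = k.
Proof.
move=> h0 k0 hk.
have real_unique (u v : L -> R) : rmean p u = 0 -> rmean p v = 0 ->
    (forall z, u z - transition Q u z = v z - transition Q v z) -> u =1 v.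
  move=> u0 v0 uv z.
  have D0 := harmonic_cst Q_trans Q_irr Q_aper p_stat (v := fun z => u z - v z).
  have Dh x : transition Q (fun z => u z - v z) x = u x - v x.
    have -> : transition Q (fun z => u z - v z) x = transition Q u x - transition Q v x.
      by rewrite /transition -sumrB; apply: eq_bigr => y _; rewrite mulrBr.
    by have := uv x; lra.
  by have := D0 Dh z; rewrite rmeanB u0 v0; lra.
apply/funext => z; apply: eq_complexP.
  apply: (real_unique (re_part h) (re_part k)).
  - by rewrite -re_mean h0.
  - by rewrite -re_mean k0.
  - move=> x; rewrite -!re_transition /re_part.
    by have := congr1 (@complex.Re R) (hk x); rewrite !(ReB, ImB).
apply: (real_unique (im_part h) (im_part k)).
- by rewrite -im_mean h0.
- by rewrite -im_mean k0.
- move=> x; rewrite -!im_transition /im_part.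
  by have := congr1 (@complex.Im R) (hk x); rewrite !(ReB, ImB).
Qed.

Lemma complex_poisson_exists h : exists k, mean p k = 0 /\
  forall z, k z - apply_transition Q k z = centered p h z.
Proof.
have [u u0 uP] : exists2 u, rmean p u = 0 & forall z,
    u z - transition Q u z = re_part (centered p h) z.
  by apply: poisson_exists => //; rewrite -re_mean mean_centered.
have [v v0 vP] : exists2 v, rmean p v = 0 & forall z,
    v z - transition Q v z = im_part (centered p h) z.
  by apply: poisson_exists => //; rewrite -im_mean mean_centered.
exists (fun z => u z +i* v z)%C; split.
  by apply: eq_complexP; rewrite ?re_mean ?im_mean.
move=> z; apply: eq_complexP; rewrite (ReB, ImB).
  by rewrite -/(re_part (apply_transition _ _) z) re_transition -[RHS]uP.
by rewrite -/(im_part (apply_transition _ _) z) im_transition -[RHS]vP.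
Qed.

(** Since [Qsharp] is a choice among the operators with the specification, it
   suffices to exhibit one: send [h] to the solution of the Poisson equation for
   [h - E_p h]. Linearity comes from uniqueness of that solution. *)
Lemma Qsharp_spec : is_Qsharp Q p (Qsharp Q p).
Proof.
have [S SP] := choice complex_poisson_exists.
apply: (@xgetPex _ (fun _ _ => 0) [set S | is_Qsharp Q p S]); exists S.
split=> [a h1 h2||h h0].
- have [m e] := SP (fun z => a * h1 z + h2 z).
  have [m1 e1] := SP h1; have [m2 e2] := SP h2.
  apply: complex_poisson_unique => //; first by rewrite mean_linear m1 m2 mulr0 addr0.
  move=> z; rewrite e apply_transition_linear /centered mean_linear.
  transitivity (a * (S h1 z - apply_transition Q (S h1) z) +
      (S h2 z - apply_transition Q (S h2) z)); last by ring.
  by rewrite e1 e2 /centered; ring.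
- have [m e] := SP (fun=> 1).
  have z0 (q : L -> R) : \sum_z (q z)%:C * (0 : R[i]) = 0.
    by rewrite big1// => z _; rewrite mulr0.
  apply: complex_poisson_unique => //; first exact: z0.
  by move=> z; rewrite e /centered mean_one subrr /apply_transition z0 subr0.
- have [m e] := SP h; have [m' e'] := SP (fun z => h z - apply_transition Q h z).
  split=> //; first by apply/funext => z; rewrite e /centered h0 subr0.
  apply: complex_poisson_unique => // z; rewrite e' /centered.
  have -> : (fun z => h z - apply_transition Q h z) =
      (fun z => -1 * apply_transition Q h z + h z).
    by apply/funext => x; rewrite mulN1r addrC.
  by rewrite mean_linear mean_apply_transition h0 mulr0 addr0 subr0.
Qed.

Lemma centered_realE (g : L -> R[i]) : (forall z, g z \is Num.real) ->
  forall z, centered p g z = (re_part (centered p g) z)%:C.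
Proof.
move=> g_real z; rewrite RRe_real// /centered rpredB// /mean rpred_sum// => y _.
by rewrite rpredM// complex_real.
Qed.

(** With [t = Q u], [E_p (u^2 - t^2) = E_p (Q (u^2) - t^2)] by stationarity, and
   [Q (u^2) - t^2] is the conditional variance of the increment. *)
Lemma asymptotic_variance_martingale (g : L -> R[i]) (u : L -> R) :
  (forall z, g z \is Num.real) -> rmean p u = 0 ->
  (forall z, u z - transition Q u z = re_part (centered p g) z) ->
  asymptotic_variance Q p g = (rmean p (increment_variance Q u))%:C.
Proof.
move=> g_real u0 uP.
have cE := centered_realE g_real.
pose h z : R[i] := (u z)%:C.
have h0 : mean p h = 0.
  by apply: eq_complexP; rewrite ?re_mean ?im_mean//; exact: (rmean_cst p_stat 0).
have hP : (fun z => h z - apply_transition Q h z) = centered p g.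
  apply/funext => z; rewrite cE -uP; apply: eq_complexP; rewrite (ReB, ImB)/=.
    by rewrite -/(re_part (apply_transition _ _) z) re_transition.
  rewrite -/(im_part (apply_transition _ _) z) im_transition.
  by rewrite (transition_cst Q_trans 0) subrr.
have Qh : Qsharp Q p (centered p g) = h.
  by case: Qsharp_spec => _ _ /(_ h h0)[_ _]; rewrite hP.
rewrite /asymptotic_variance Qh.
have -> : (fun z => centered p g z * (2 * h z - centered p g z)) =
    (fun z => ((u z) ^+ 2 - (transition Q u z) ^+ 2)%:C).
  apply/funext => z; rewrite cE -uP /h -(rmorph_nat (real_complex R) 2).
  by rewrite -rmorphM -rmorphB -rmorphM; congr (_%:C); ring.
apply: eq_complexP; rewrite ?re_mean ?im_mean/=; last exact: (rmean_cst p_stat 0).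
rewrite (rmeanB p (fun z => u z ^+ 2)) -(rmean_transition p_stat) -rmeanB.
apply: eq_bigr => z _; congr (_ * _); rewrite /increment_variance /increment.
have -> : \sum_z' Q z z' * (u z' - transition Q u z) ^+ 2 =
   transition Q (fun z => u z ^+ 2) z - 2 * transition Q u z * (\sum_z' Q z z' * u z')
   + transition Q u z ^+ 2 * (\sum_z' Q z z').
  move: (transition Q u z) => t; rewrite /transition !mulr_sumr -sumrN -!big_split.
  by apply: eq_bigr => y _ /=; ring.
by rewrite -/(transition Q u z) (proj2 (Q_trans z)); ring.
Qed.

End ComplexFunctions.


(** * The weak law and conclusion *)

Section PathWeakLaw.
Variables (R : realType) (L : finType) (Q : L -> L -> R) (mu p psi : L -> R).
Hypothesis Q_trans : is_transition_function Q.
Hypothesis Q_irr : irreducible_transition Q.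
Hypothesis Q_aper : aperiodic_transition Q.
Hypothesis p_stat : is_stationary p Q.
Hypothesis mu_distr : is_distribution mu.
Hypothesis psi_gt0 : forall z, 0 < psi z.

Lemma re_path_sum (c : L -> R[i]) n (q : path_space L n) :
  complex.Re (path_sum c q) = path_sum (re_part c) q.
Proof. by elim: n q => [|n IH] q //=; rewrite -IH; exact: raddfD. Qed.

Lemma im_path_sum (c : L -> R[i]) n (q : path_space L n) :
  complex.Im (path_sum c q) = path_sum (im_part c) q.
Proof. by elim: n q => [|n IH] q //=; rewrite -IH; exact: raddfD. Qed.

(** Chebyshev's inequality for the real and imaginary parts. *)
Lemma path_wlln (c : L -> R[i]) (eps : R) : mean p c = 0 -> 0 < eps ->
  tilted_mean Q mu psi (fun q : path_space L n =>
    (eps%:C < `|path_sum c q / n.+1%:R|)%R%:R) @[n --> \oo] --> (0 : R).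
Proof.
move=> c0 e0.
have [u _ uP] : exists2 u, rmean p u = 0 & forall z,
    u z - transition Q u z = re_part c z.
  by apply: poisson_exists => //; rewrite -re_mean c0.
have [v _ vP] : exists2 v, rmean p v = 0 & forall z,
    v z - transition Q v z = im_part c z.
  by apply: poisson_exists => //; rewrite -im_mean c0.
have [B1 B10 B1P] := path_sum_second_moment Q_trans mu_distr uP.
have [B2 B20 B2P] := path_sum_second_moment Q_trans mu_distr vP.
have [A A0 AP] := tilted_mean_le_mean Q_trans mu_distr psi_gt0.
pose K := A * (eps ^- 2 * (B1 + B2)).
have cheb n (q : path_space L n) : (eps%:C < `|path_sum c q / n.+1%:R|)%R%:R <=
    eps ^- 2 * n.+1%:R ^- 2 * (path_sum (re_part c) q ^+ 2 + path_sum (im_part c) q ^+ 2).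
  have n0 : 0 < n.+1%:R :> R by rewrite ltr0n.
  have -> : `|path_sum c q / n.+1%:R| =
      (Num.sqrt (path_sum (re_part c) q ^+ 2 + path_sum (im_part c) q ^+ 2) / n.+1%:R)%:C.
    rewrite normrM normfV normr_nat normc_def re_path_sum im_path_sum.
    by rewrite -(rmorph_nat (real_complex R)) -fmorphV -rmorphM.
  rewrite ltcR; set s := _ ^+ 2 + _ ^+ 2.
  have s0 : 0 <= s by rewrite addr_ge0// sqr_ge0.
  have ei : 0 < eps ^- 2 * n.+1%:R ^- 2 by rewrite mulr_gt0// invr_gt0 exprn_gt0.
  case: ltP => [lt|_]; last by rewrite mulr_ge0// ltW.
  rewrite ltr_pdivlMr// in lt.
  have : (eps * n.+1%:R) ^+ 2 <= s.
    rewrite -[leRHS](sqr_sqrtr s0) lerXn2r ?nnegrE ?sqrtr_ge0 ?(ltW lt)//.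
    by rewrite mulr_ge0// ltW.
  move=> H; apply: le_trans (ler_wpM2l (ltW ei) H).
  rewrite exprMn mulrACA !mulVf ?mulr1//; rewrite expf_neq0// lt0r_neq0//.
have up n : tilted_mean Q mu psi (fun q : path_space L n =>
    (eps%:C < `|path_sum c q / n.+1%:R|)%R%:R) <= K * n.+1%:R^-1.
  have n0 : 0 < n.+1%:R :> R by rewrite ltr0n.
  apply: le_trans (AP _ _ _) _ => //.
  rewrite -mulrA ler_wpM2l//.
  apply: le_trans (path_mean_le Q_trans mu_distr (cheb n)) _.
  rewrite path_meanZ path_meanD.
  have ei : 0 <= eps ^- 2 * n.+1%:R ^- 2 by rewrite mulr_ge0// invr_ge0 exprn_ge0// ltW.
  apply: le_trans (ler_wpM2l ei (lerD (B1P n) (B2P n))) _.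
  by rewrite le_eqVlt; apply/orP; left; apply/eqP; field; rewrite !lt0r_neq0.
have lo n : 0 <= tilted_mean Q mu psi (fun q : path_space L n =>
    (eps%:C < `|path_sum c q / n.+1%:R|)%R%:R).
  rewrite -(tilted_mean_cst Q_trans mu_distr psi_gt0 n 0).
  exact: tilted_mean_le.
have lim : K * n.+1%:R^-1 @[n --> \oo] --> (0 : R).
  by rewrite -(mulr0 K); apply: cvgMr; exact: cvg_harmonic.
apply: (squeeze_cvgr _ (cvg_cst 0) lim).
by apply: nearW => n; rewrite lo up.
Qed.

End PathWeakLaw.

Theorem theorem3p3 (R : realType) (L : finType)
    (Q : L -> L -> R) (piQ mu phi : L -> R)
    (Q_trans : is_transition_function Q)
    (Q_irr : irreducible_transition Q)
    (Q_aper : aperiodic_transition Q)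
    (piQ_stat : is_stationary piQ Q)
    (mu_distr : is_distribution mu)
    (phi_gt0 : forall z, 0 < phi z)
    (d : measure_display) (T : measurableType d) (P : probability T R)
    (Z : nat -> T -> L) (Z_chain : is_markov_chain P Z mu Q)
    (g : L -> R[i]) :
  let Sn := additive_functional Z (centered piQ g) in
  let Qn := tilted_prob P Z phi in
  let sigma2 := asymptotic_variance Q piQ g in
  (forall eps : R, 0 < eps ->
     Qn n [set w | eps%:C < `|Sn n w / n.+1%:R|] @[n --> \oo] --> (0 : R))
  /\
  ((forall z, g z \is Num.real) ->
     0 <= sigma2 /\
     cvg_in_distribution
       (fun n x => Qn n [set w | Sn n w / (Num.sqrt n.+1%:R)%:C <= x%:C])
       (centered_normal_cdf (complex.Re sigma2))).
Proof.
move=> Sn Qn sigma2.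
have psi_gt0 z : 0 < (phi z)^-1 by rewrite invr_gt0.
have mc := mean_centered piQ_stat g.
split=> [eps eps0|g_real].
  rewrite [X in X @ _ --> _](_ : _ = (fun n => tilted_mean Q mu
    (fun z => (phi z)^-1) (fun q : path_space L n =>
      (eps%:C < `|path_sum (centered piQ g) q / n.+1%:R|)%R%:R))).
    exact: (path_wlln Q_trans Q_irr Q_aper piQ_stat mu_distr psi_gt0 mc eps0).
  apply/funext => n.
  rewrite -(tilted_prob_trajectory Z_chain _ phi_gt0).
  by congr (tilted_prob _ _ _ _ _); apply/funext => w /=; rewrite path_sum_trajectory.
have [u u0 uP] : exists2 u, rmean piQ u = 0 & forall z,
    u z - transition Q u z = re_part (centered piQ g) z.
  by apply: poisson_exists => //; rewrite -re_mean mc.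
have vE := asymptotic_variance_martingale Q_trans Q_irr Q_aper piQ_stat g_real u0 uP.
rewrite /sigma2 vE; split.
  by rewrite lecR; exact: (mean_variance_ge0 Q_trans piQ_stat).
rewrite (_ : (fun n x => Qn n _) = (fun n x => tilted_mean Q mu
    (fun z => (phi z)^-1) (fun q : path_space L n =>
      (path_sum (re_part (centered piQ g)) q / Num.sqrt n.+1%:R <= x)%R%:R))).
  exact: (path_clt Q_trans Q_irr Q_aper piQ_stat mu_distr psi_gt0 uP).
apply/funext => n; apply/funext => x.
rewrite -(tilted_prob_trajectory Z_chain _ phi_gt0).
congr (tilted_prob _ _ _ _ _); apply/funext => w /=.
rewrite /Sn -path_sum_trajectory -lecR.
have -> : path_sum (centered piQ g) (trajectory Z n w) =
    (path_sum (re_part (centered piQ g)) (trajectory Z n w))%:C.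
  elim: (n) => [|k IH] /=; first exact: centered_realE.
  by rewrite IH rmorphD/= -centered_realE.
by rewrite rmorphM/= fmorphV.
Qed.
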